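(* Let $L_1,\dots,L_m\subset\mathbb{R}^{2n}$ be Lagrangian subspaces with frames $Y_1,\dots,Y_m$ (the columns of $Y_j$ form a basis of $L_j$). For $m=3$, $$\tau(L_1,L_2,L_3)=\mu_c^{+}(Y_1,Y_2,Y_3)-\mu_c^{-}(Y_1,Y_2,Y_3)=\nu_c^{+}(Y_1,Y_2,Y_3)-\nu_c^{-}(Y_1,Y_2,Y_3).$$ For every $m\ge3$, $$\tau(L_1,\dots,L_m)=\mu_c^{+}(Y_1,\dots,Y_m)-\mu_c^{-}(Y_1,\dots,Y_m)=\nu_c^{+}(Y_1,\dots,Y_m)-\nu_c^{-}(Y_1,\dots,Y_m),$$ $$\mu_c^{\pm}(Y_1,\dots,Y_m)=\tfrac12\Bigl(\sum_{j=1}^{m-1}\operatorname{rank}w(Y_j,Y_{j+1})+\operatorname{rank}w(Y_m,Y_1)\pm\tau(L_1,\dots,L_m)\Bigr),$$ $$\nu_c^{\pm}(Y_1,\dots,Y_m)=\tfrac12\Bigl(\sum_{j=1}^{m-1}\operatorname{rank}w(Y_j,Y_{j+1})-\operatorname{rank}w(Y_m,Y_1)\pm\tau(L_1,\dots,L_m)\Bigr).$$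
   Context: $\mathcal{J}=\begin{pmatrix}0&I\\-I&0\end{pmatrix}\in\mathbb{R}^{2n\times 2n}$ and $w(Y,\hat Y)=Y^T\mathcal{J}\hat Y$ (also used for vectors: $w(x,y)=x^T\mathcal{J}y$). For a real symmetric matrix $A$, $\operatorname{ind}A$ is the number of negative eigenvalues counted with multiplicity. $A^{\dagger}$ is the Moore–Penrose pseudoinverse. A frame is a real $2n\times n$ matrix $Y$ with $w(Y,Y)=0$ and $\operatorname{rank}Y=n$. For frames $Y=\binom{X}{U}$, $\hat Y=\binom{\hat X}{\hat U}$ ($n\times n$ blocks) put $\mathcal M=(I-X^{\dagger}X)\,w(Y,\hat Y)$, $\mathcal T=I-\mathcal M^{\dagger}\mathcal M$, $\mathcal P=\mathcal T\,w(Y,\hat Y)^T X^{\dagger}\hat X\,\mathcal T$ (symmetric), and define the comparative index and dual comparative index $\mu(Y,\hat Y)=\operatorname{rank}\mathcal M+\operatorname{ind}\mathcal P$, $\mu^*(Y,\hat Y)=\operatorname{rank}\mathcal M+\operatorname{ind}(-\mathcal P)$. Cyclic sums, $m\ge2$: $\mu_c^-(Y_1,\dots,Y_m)=\sum_{k=1}^{m-1}\mu(Y_k,Y_{k+1})+\mu(Y_m,Y_1)$, $\mu_c^+(Y_1,\dots,Y_m)=\sum_{k=1}^{m-1}\mu^*(Y_k,Y_{k+1})+\mu^*(Y_m,Y_1)$, $\nu_c^-(Y_1,\dots,Y_m)=\sum_{k=1}^{m-1}\mu(Y_k,Y_{k+1})-\mu(Y_1,Y_m)$, $\nu_c^+(Y_1,\dots,Y_m)=\sum_{k=1}^{m-1}\mu^*(Y_k,Y_{k+1})-\mu^*(Y_1,Y_m)$.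 Kashiwara index: $\tau(L_1,L_2,L_3)$ is the signature (number of positive minus number of negative squares) of the quadratic form $B(x,x)=w(x_1,x_2)+w(x_2,x_3)+w(x_3,x_1)$ on $(x_1,x_2,x_3)\in L_1\oplus L_2\oplus L_3$ (external direct sum). For $m\ge3$, $\tau(L_1,\dots,L_m)=\sum_{j=2}^{m-1}\tau(L_1,L_j,L_{j+1})$. *)

(* Defs.v *)
From HB Require Import structures.
From mathcomp Require Import all_boot all_order all_algebra.
From mathcomp Require Import polyrcf.
From mathcomp Require Import boolp classical_sets reals.

Set Implicit Arguments.
Unset Strict Implicit.
Unset Printing Implicit Defensive.

Import Order.TTheory GRing.Theory Num.Theory.

Local Open Scope ring_scope.

Definition is_pinv (R : realType) (m n : nat)
    (A : 'M[R]_(m, n)) (B : 'M[R]_(n, m)) : bool :=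
  [&& A *m B *m A == A, B *m A *m B == B,
      (A *m B)^T == A *m B & (B *m A)^T == B *m A].

Lemma row_sqr_eq0 (R : realType) (n : nat) (u : 'rV[R]_n) :
  u *m u^T = 0 -> u = 0.
Proof.
move=> /matrixP/(_ 0 0); rewrite !mxE => h; apply/rowP=> i; rewrite mxE.
have /psumr_eq0P : \sum_j u 0 j ^+ 2 = 0.
  by rewrite -[RHS]h; apply: eq_bigr => j _; rewrite mxE.
move=> /(_ (fun j _ => sqr_ge0 _)) /(_ i isT) /eqP.
by rewrite sqrf_eq0 => /eqP.
Qed.

Lemma row_free_gram (R : realType) (m n : nat) (F : 'M[R]_(m, n)) :
  row_free F -> F *m F^T \in unitmx.
Proof.
move=> Ffree; rewrite -row_free_unit -kermx_eq0.
apply/eqP/row_matrixP=> i; rewrite row0.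
set u := row i _.
have uG : u *m (F *m F^T) = 0.
  by apply/sub_kermxP; exact: row_sub.
have : (u *m F) *m (u *m F)^T = 0.
  by rewrite trmx_mul mulmxA -[u *m F *m F^T]mulmxA uG mul0mx.
by move/row_sqr_eq0 => uF; apply: (row_free_inj Ffree); rewrite uF mul0mx.
Qed.

Lemma ex_pinv (R : realType) (m n : nat) (A : 'M[R]_(m, n)) :
  exists B, is_pinv A B.
Proof.
have [r [C [F [-> Cfull Ffree]]]] : exists r (C : 'M[R]_(m, r)) (F : 'M_(r, n)),
    [/\ A = C *m F, row_full C & row_free F].
  exists (\rank A), (col_base A), (row_base A).
  by rewrite mulmx_base col_base_full row_base_free.
have uF : F *m F^T \in unitmx by exact: row_free_gram.
have uC : C^T *m C \in unitmx.
  by rewrite -{2}(trmxK C); apply: row_free_gram; rewrite /row_free mxrank_tr.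
set K := invmx (F *m F^T); set H := invmx (C^T *m C).
have KT : K^T = K by rewrite /K trmx_inv trmx_mul trmxK.
have HT : H^T = H by rewrite /H trmx_inv trmx_mul trmxK.
exists (F^T *m K *m H *m C^T).
have eAB : C *m F *m (F^T *m K *m H *m C^T) = C *m H *m C^T.
  rewrite !mulmxA -(mulmxA C F) -(mulmxA C (F *m F^T)).
  by rewrite (mulmxV uF) mulmx1.
have eBA : F^T *m K *m H *m C^T *m (C *m F) = F^T *m K *m F.
  rewrite !mulmxA -(mulmxA _ C^T C) -(mulmxA (F^T *m K) H).
  by rewrite (mulVmx uC) mulmx1.
apply/and4P; split; apply/eqP.
- by rewrite eAB !mulmxA -(mulmxA _ C^T C) -(mulmxA C H) (mulVmx uC) mulmx1.
- rewrite eBA !mulmxA -(mulmxA _ F F^T) -(mulmxA F^T K) (mulVmx uF).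
  by rewrite mulmx1.
- by rewrite eAB !trmx_mul trmxK HT mulmxA.
- by rewrite eBA !trmx_mul trmxK KT mulmxA.
Qed.

Lemma is_pinv_uniq (R : realType) (m n : nat) (A : 'M[R]_(m, n)) B1 B2 :
  is_pinv A B1 -> is_pinv A B2 -> B1 = B2.
Proof.
case/and4P=> /eqP a1 /eqP b1 /eqP c1 /eqP d1.
case/and4P=> /eqP a2 /eqP b2 /eqP c2 /eqP d2.
have e1 : A *m B1 = A *m B2.
  rewrite -[LHS]c1 -[in LHS]a2 -(mulmxA _ A B1) trmx_mul c1 c2.
  by rewrite mulmxA a1.
have e2 : B1 *m A = B2 *m A.
  rewrite -[LHS]d1 -[in LHS]a2 -(mulmxA A) mulmxA trmx_mul d1 d2.
  by rewrite -mulmxA (mulmxA A) a1.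
by rewrite -b1 e2 -mulmxA e1 mulmxA b2.
Qed.

(* The Moore-Penrose pseudoinverse; the library's [pinvmx] is only some partial
   inverse on the row space. *)
Definition mpinv (R : realType) (m n : nat) (A : 'M[R]_(m, n)) : 'M[R]_(n, m) :=
  xchoose (ex_pinv A).

Lemma mpinvP (R : realType) (m n : nat) (A : 'M[R]_(m, n)) :
  is_pinv A (mpinv A).
Proof. exact: xchooseP (ex_pinv A). Qed.

(* Number of negative eigenvalues, each counted with its multiplicity as a root
   of the characteristic polynomial ([rootsR] lists the distinct real roots). *)
Definition ind (R : realType) (n : nat) (A : 'M[R]_n) : nat :=
  (\sum_(a <- rootsR (char_poly A) | (a < 0)%R) mup a (char_poly A))%N.

Definition sympJ (R : realType) (n : nat) : 'M[R]_(n + n) :=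
  block_mx 0 1%:M (- 1%:M) 0.

Definition w (R : realType) (n p q : nat)
    (Y : 'M[R]_(n + n, p)) (Z : 'M[R]_(n + n, q)) : 'M[R]_(p, q) :=
  Y^T *m sympJ R n *m Z.

Definition wv (R : realType) (n : nat) (x y : 'cV[R]_(n + n)) : R := w x y 0 0.

Definition is_frame (R : realType) (n : nat) (Y : 'M[R]_(n + n, n)) : Prop :=
  w Y Y = 0 /\ \rank Y = n.

(* For Y = col_mx X U and Z = col_mx X' U' (so X = usubmx Y, X' = usubmx Z),
   the matrices M, T, P of the pair (Y, Z). *)
Definition ciM (R : realType) (n : nat) (Y Z : 'M[R]_(n + n, n)) : 'M[R]_n :=
  (1%:M - mpinv (usubmx Y) *m usubmx Y) *m w Y Z.

Definition ciT (R : realType) (n : nat) (Y Z : 'M[R]_(n + n, n)) : 'M[R]_n :=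
  1%:M - mpinv (ciM Y Z) *m ciM Y Z.

Definition ciP (R : realType) (n : nat) (Y Z : 'M[R]_(n + n, n)) : 'M[R]_n :=
  ciT Y Z *m (w Y Z)^T *m mpinv (usubmx Y) *m usubmx Z *m ciT Y Z.

Definition mu (R : realType) (n : nat) (Y Z : 'M[R]_(n + n, n)) : nat :=
  (\rank (ciM Y Z) + ind (ciP Y Z))%N.

Definition mu_star (R : realType) (n : nat) (Y Z : 'M[R]_(n + n, n)) : nat :=
  (\rank (ciM Y Z) + ind (- ciP Y Z)%R)%N.

(* Families indexed by 1, ..., m are given by functions on nat, of which only
   the values at 1, ..., m are used. *)
Definition mu_c_minus (R : realType) (n m : nat)
    (Y : nat -> 'M[R]_(n + n, n)) : int :=
  \sum_(1 <= k < m) (mu (Y k) (Y k.+1))%:Z + (mu (Y m) (Y 1%N))%:Z.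

Definition mu_c_plus (R : realType) (n m : nat)
    (Y : nat -> 'M[R]_(n + n, n)) : int :=
  \sum_(1 <= k < m) (mu_star (Y k) (Y k.+1))%:Z + (mu_star (Y m) (Y 1%N))%:Z.

Definition nu_c_minus (R : realType) (n m : nat)
    (Y : nat -> 'M[R]_(n + n, n)) : int :=
  \sum_(1 <= k < m) (mu (Y k) (Y k.+1))%:Z - (mu (Y 1%N) (Y m))%:Z.

Definition nu_c_plus (R : realType) (n m : nat)
    (Y : nat -> 'M[R]_(n + n, n)) : int :=
  \sum_(1 <= k < m) (mu_star (Y k) (Y k.+1))%:Z - (mu_star (Y 1%N) (Y m))%:Z.

Definition lagrangian (R : realType) (n : nat)
    (L : {vspace 'cV[R]_(n + n)}) : Prop :=
  \dim L = n /\ {in L &, forall x y, wv x y = 0}.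

Definition frame_of (R : realType) (n : nat)
    (L : {vspace 'cV[R]_(n + n)}) (Y : 'M[R]_(n + n, n)) : Prop :=
  is_frame Y /\ basis_of L [seq col j Y | j : 'I_n].

(* Q is diagonal in the coordinates of some basis e, with p positive and q
   negative coefficients, and s = p - q. By Sylvester's law of inertia there is
   exactly one such s for a quadratic form Q. *)
Definition is_signature (R : realType) (V : vectType R) (Q : V -> R) (s : int)
    : Prop :=
  exists (N : nat) (e : N.-tuple V) (d : 'I_N -> R),
    [/\ basis_of fullv e,
        forall v, Q v = \sum_(i < N) d i * coord e i v ^+ 2
      & s = #|[pred i | 0 < d i]|%:Z - #|[pred i | d i < 0]|%:Z].

Definition signature (R : realType) (V : vectType R) (Q : V -> R) : int :=
  xget 0 (fun s => is_signature Q s).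

(* The external direct sum of L1, L2, L3 is the product of the subspaces viewed
   as vector spaces. *)
Definition kashiwara_form (R : realType) (n : nat)
    (L1 L2 L3 : {vspace 'cV[R]_(n + n)})
    (x : subvs_of L1 * subvs_of L2 * subvs_of L3) : R :=
  let x1 := vsval x.1.1 in let x2 := vsval x.1.2 in let x3 := vsval x.2 in
  wv x1 x2 + wv x2 x3 + wv x3 x1.

Definition tau3 (R : realType) (n : nat)
    (L1 L2 L3 : {vspace 'cV[R]_(n + n)}) : int :=
  signature (@kashiwara_form R n L1 L2 L3).

Definition tau (R : realType) (n m : nat)
    (L : nat -> {vspace 'cV[R]_(n + n)}) : int :=
  \sum_(2 <= j < m) tau3 (L 1%N) (L j) (L j.+1).

Definition rank_sum (R : realType) (n m : nat)
    (Y : nat -> 'M[R]_(n + n, n)) : int :=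
  \sum_(1 <= j < m) (\rank (w (Y j) (Y j.+1)))%:Z.

(* Main.v *)
(* For all but finitely many t the Lagrangian {(x, t x)} is transverse to the
   vertical subspace V = {(0, u)} and to all the L_j; relative to this splitting
   L_j is the graph of a symmetric matrix A_j, the matrix of V being 0, and
   w(Y_j, Y_k) is equivalent to A_j - A_k. In these coordinates the Kashiwara
   form of (L_1, L_2, L_3) is congruent to
   diag(A_1 - A_2, A_2 - A_3, A_3 - A_1).

   On the other hand, eliminating variables, the Kashiwara form of (V, Y, Z) is
   congruent to a hyperbolic form of rank rank X + rank M plus the form of P, so
   its negative and positive indices are rank X + mu(Y, Z) and
   rank X + mu^*(Y, Z). Comparing the two descriptions,
     mu(Y_j, Y_k) = ind (A_j - A_k) + ind A_k - ind A_j,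
     mu^*(Y_j, Y_k) = ind (A_k - A_j) + ind (- A_k) - ind (- A_j),
   and all the cyclic sums telescope. *)
Require Import Defs.
From HB Require Import structures.
From mathcomp Require Import all_boot all_order all_algebra.
From mathcomp Require Import complex polyrcf.
From mathcomp Require Import boolp classical_sets reals.
From mathcomp Require Import ring zify.

Set Implicit Arguments.
Unset Strict Implicit.
Unset Printing Implicit Defensive.

Import Order.TTheory GRing.Theory Num.Theory.

Local Open Scope ring_scope.

(** * Spectral decomposition and negative eigenvalues *)

(** Over the complex field the characteristic polynomial has a root [l]. For an eigenvector [v], the
    number [v *m Ac *m vc] is [l] times the nonzero squared norm [N] and is its own conjugate, so
    [l] is real. *)
Lemma sym_eigenvalue (R : rcfType) (n : nat) (A : 'M[R]_n.+1) :
  A^T = A -> exists a, eigenvalue A a.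
Proof.
move=> symA; pose f := real_complex R; pose Ac := map_mx f A.
have [l] : exists l, root (char_poly Ac) l.
  by apply/closed_rootP; rewrite size_char_poly.
move=> rl; have /eigenvalueP [v vA v0] : eigenvalue Ac l.
  by rewrite eigenvalue_root_char.
pose vc := (map_mx Num.conj v)^T.
have AcE : map_mx Num.conj Ac = Ac.
  by apply/matrixP => i j; rewrite !mxE; apply: conj_Creal; rewrite complex_real.
have AcT : Ac^T = Ac by rewrite /Ac -[in RHS]symA; apply/matrixP => i j; rewrite !mxE.
pose N := \sum_i v 0 i * Num.conj (v 0 i).
have NE : v *m vc = N%:M.
  rewrite [LHS]mx11_scalar !mxE; congr (_%:M).
  by apply: eq_bigr => i _; rewrite !mxE.
have N0 : N != 0.
  apply: contra v0 => /eqP; rewrite /N => /psumr_eq0P h.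
  apply/eqP/rowP => i; rewrite mxE; apply/eqP.
  by rewrite -mul_conjC_eq0; apply/eqP/h => // j _; apply: mul_conjC_ge0.
have lreal : Num.conj l = l.
  have E1 : v *m Ac *m vc = (l * N)%:M by rewrite vA -scalemxAl NE scale_scalar_mx.
  have : (map_mx Num.conj (v *m Ac *m vc))^T = v *m Ac *m vc.
    rewrite !map_mxM !trmx_mul AcE AcT -/vc mulmxA; congr (_ *m _ *m _).
    by apply/matrixP => i j; rewrite !mxE; exact: conjCK.
  rewrite E1 => /matrixP/(_ 0 0); rewrite !mxE eqxx !mulr1n rmorphM /=.
  have -> : Num.conj N = N.
    rewrite rmorph_sum; apply: eq_bigr => i _.
    by rewrite rmorphM [X in _ * X]conjCK mulrC.
  by move/(mulIf N0).
have lE : l = f (complex.Re l).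
  by rewrite /f /=; apply/esym/RRe_real; apply/CrealP.
exists (complex.Re l); rewrite eigenvalue_root_char.
by move: rl; rewrite {1}lE /Ac -map_char_poly -(fmorph_root f).
Qed.

(** The reflection exchanging the first basis vector [e] with the normalized [v]; it splits off an
    eigenvector in the induction of [sym_diagonalizable]. *)
Lemma householder (R : realType) (n : nat) (v : 'rV[R]_(1 + n)) :
  v != 0 -> exists (H : 'M[R]_(1 + n)) (c : R),
    H *m H^T = 1%:M /\ row 0 H = c *: v.
Proof.
move=> v0; pose s := (v *m v^T) 0 0.
have sE : v *m v^T = s%:M by exact: mx11_scalar.
have s0 : 0 < s.
  have sq : s = \sum_i v 0 i ^+ 2.
    by rewrite /s mxE; apply: eq_bigr => i _; rewrite mxE.
  rewrite lt_neqAle eq_sym sq sumr_ge0 ?andbT => [|i _]; last exact: sqr_ge0.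
  rewrite -sq; apply: contra v0 => /eqP s0; apply/eqP/row_sqr_eq0.
  by rewrite sE s0 raddf0.
pose c := (Num.sqrt s)^-1; pose u := c *: v.
have uu : u *m u^T = 1%:M.
  rewrite /u linearZ /= -scalemxAl -scalemxAr sE scalerA scale_scalar_mx.
  congr (_%:M); rewrite /c -expr2 exprVn sqr_sqrtr ?mulVf ?lt0r_neq0 //.
  exact: ltW.
pose e : 'rV[R]_(1 + n) := delta_mx 0 0.
have ee : e *m e^T = 1%:M.
  by rewrite /e trmx_delta mul_delta_mx; apply/matrixP => i j; rewrite !mxE !ord1.
(* The mirror is the hyperplane orthogonal to [e - u], which degenerates when [u = e]; the identity
   then serves. *)
have [ue|une] := eqVneq u e.
  by exists 1%:M, c; rewrite trmx1 mulmx1 row1 -/u ue.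
pose x := e - u; pose t := (x *m x^T) 0 0; pose r := (u *m e^T) 0 0.
have tE : x *m x^T = t%:M by exact: mx11_scalar.
have rE : u *m e^T = r%:M by exact: mx11_scalar.
have rE' : e *m u^T = r%:M.
  by rewrite -(trmxK e) -trmx_mul rE tr_scalar_mx.
have tr : t = 2 * (1 - r).
  have : x *m x^T = (2 * (1 - r))%:M.
    rewrite /x raddfB /= mulmxBl !mulmxBr ee uu rE rE' -!raddfB /=.
    by congr (_%:M); ring.
  by rewrite tE => /matrixP/(_ 0 0); rewrite !mxE eqxx !mulr1n.
have t0 : t != 0.
  apply/eqP => t0; case/eqP: une; apply/esym/subr0_eq/row_sqr_eq0.
  by rewrite -/x tE t0 raddf0.
pose H := 1%:M - (2 / t) *: (x^T *m x).
have HT : H^T = H by rewrite /H raddfB /= trmx1 linearZ /= trmx_mul trmxK.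
exists H, c; split.
  have xx : x^T *m x *m (x^T *m x) = t *: (x^T *m x).
    by rewrite mulmxA -(mulmxA x^T) tE mul_mx_scalar -scalemxAl.
  rewrite HT {2}/H mulmxBr mulmx1 /H mulmxBl mul1mx.
  rewrite -scalemxAl -!scalemxAr xx !scalerA -scalerBl.
  rewrite -addrA -opprD -scalerDl.
  have -> : 2 / t + (2 / t - 2 / t * (2 / t) * t) = 0 by field.
  by rewrite scale0r subr0.
rewrite -/u rowE -/e /H mulmxBr mulmx1 -scalemxAr mulmxA.
have -> : e *m x^T = (1 - r)%:M.
  by rewrite /x linearB /= mulmxBr ee rE' -raddfB.
rewrite mul_scalar_mx scalerA.
have -> : 2 / t * (1 - r) = 1 by rewrite mulrAC -tr divff.
by rewrite scale1r /x opprB addrCA subrr addr0.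
Qed.

(** Conjugation by a reflection whose first row is an eigenvector clears the rest of the first row
    and, by symmetry, of the first column; induction treats the remaining block. *)
Lemma sym_diagonalizable (R : realType) (n : nat) (A : 'M[R]_n) :
  A^T = A -> exists (O : 'M[R]_n) (d : 'rV[R]_n),
    O *m O^T = 1%:M /\ A = O^T *m diag_mx d *m O.
Proof.
elim: n A => [|n IH] A symA.
  by exists 1%:M, 0; split; apply/matrixP => -[].
have [a /eigenvalueP [v vA v0]] := sym_eigenvalue symA.
have [H [c [HH rH]]] := @householder R n v v0.
have HH' : H^T *m H = 1%:M by exact: mulmx1C.
pose B : 'M[R]_(1 + n) := H *m (A : 'M_(1 + n)) *m H^T.
have BT : B^T = B by rewrite /B !trmx_mul trmxK symA mulmxA.
have r0B : row 0 B = a *: delta_mx 0 0.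
  rewrite /B !row_mul rH -scalemxAl vA scalerA mulrC -scalerA -rH.
  by rewrite -scalemxAl -row_mul HH row1.
have ulB : ulsubmx B = a%:M.
  apply/matrixP => i j; move: r0B => /rowP /(_ 0); rewrite !mxE !ord1 /=.
  by rewrite !lshift0 mulr1 => ->.
have urB : ursubmx B = 0.
  apply/matrixP => i j; move: r0B => /rowP /(_ (rshift 1 j)); rewrite !mxE !ord1 /=.
  by rewrite lshift0 mulr0 => ->.
have dlB : dlsubmx B = 0 by rewrite -BT -trmx_ursub urB trmx0.
have [O [d [OO dO]]] : exists (O : 'M[R]_n) (d : 'rV[R]_n),
    O *m O^T = 1%:M /\ drsubmx B = O^T *m diag_mx d *m O.
  by apply: IH; rewrite trmx_drsub BT.
have BE : B = block_mx a%:M 0 0 (drsubmx B) by rewrite -{1}(submxK B) ulB urB dlB.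
pose O1 : 'M[R]_(1 + n) := block_mx 1%:M 0 0 O.
have O1T : O1^T = block_mx 1%:M 0 0 O^T by rewrite /O1 tr_block_mx !trmx0 trmx1.
have OO1 : O1 *m O1^T = 1%:M.
  rewrite O1T /O1 mulmx_block !mulmx0 !mul0mx !addr0 add0r mulmx1 OO.
  by rewrite -scalar_mx_block.
pose d1 : 'rV[R]_(1 + n) := row_mx a%:M d.
have BD : B = O1^T *m diag_mx d1 *m O1.
  rewrite O1T BE dO /O1 diag_mx_row !mulmx_block.
  rewrite !(mulmx0, mul0mx, addr0, add0r, mul1mx, mulmx1).
  by congr block_mx; apply/matrixP => i j; rewrite !mxE !ord1 eqxx mulr1n.
exists (O1 *m H), d1; split.
  by rewrite trmx_mul mulmxA -(mulmxA O1) HH mulmx1.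
have -> : A = H^T *m B *m H.
  by rewrite /B !mulmxA HH' mul1mx -mulmxA HH' mulmx1.
by rewrite BD trmx_mul !mulmxA.
Qed.

Lemma char_poly_similar (R : comNzRingType) (n : nat) (O P D : 'M[R]_n) :
  P *m O = 1%:M -> char_poly (P *m D *m O) = char_poly D.
Proof.
move=> PO; have OP : O *m P = 1%:M by exact: mulmx1C.
pose c := @polyC R.
have PO' : map_mx c P *m map_mx c O = 1%:M by rewrite -map_mxM PO map_mx1.
rewrite /char_poly.
have -> : char_poly_mx (P *m D *m O)
    = map_mx c P *m char_poly_mx D *m map_mx c O.
  rewrite /char_poly_mx mulmxBr mulmxBl !map_mxM; congr (_ - _).
  by rewrite mul_mx_scalar -scalemxAl PO' scalemx1.
by rewrite !det_mulmx mulrAC -det_mulmx PO' det1 mul1r.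
Qed.

(** The characteristic polynomial is the product of the factors ['X - (d 0 i)%:P], so a root has as
    multiplicity the number of indices carrying it; exchanging the two sums counts each negative
    entry once. *)
Lemma ind_diagonal (R : realType) (n : nat) (A O : 'M[R]_n) (d : 'rV[R]_n) :
  O *m O^T = 1%:M -> A = O^T *m diag_mx d *m O ->
  ind A = #|[pred i | d 0 i < 0]|.
Proof.
move=> /mulmx1C OO ->; rewrite /ind char_poly_similar //.
have -> : char_poly (diag_mx d) = \prod_(x <- [seq d 0 i | i : 'I_n]) ('X - x%:P).
  rewrite char_poly_trig ?diag_mx_is_trig // big_image /=.
  by apply: eq_bigr => i _; rewrite mxE eqxx mulr1n.
set s := [seq _ | _ : _]; set p := \prod_(x <- s) _.
have p0 : p != 0 by apply/monic_neq0/monic_prod_XsubC.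
transitivity (\sum_(a <- rootsR p | (a < 0)%R) \sum_(i < n) (d 0%R i == a))%N.
  apply: eq_bigr => a _; rewrite mu_prod_XsubC /s count_map -sum1_count.
  by rewrite big_mkcond big_enum /=; apply: eq_bigr => i _; case: eqP.
rewrite exchange_big -sum1_card [RHS]big_mkcond /=; apply: eq_bigr => i _.
rewrite inE; have [di|di] := boolP (d 0 i < 0); last first.
  rewrite big1_seq // => a /andP [a0 _]; case: eqP => // e.
  by rewrite -e (negbTE di) in a0.
have ri : d 0 i \in rootsR p.
  rewrite -(@roots_on_rootsR _ _ p0) inE /= root_prod_XsubC.
  by apply/mapP; exists i; rewrite ?mem_enum.
rewrite -big_filter (bigD1_seq (d 0 i)) /= ?eqxx ?mem_filter ?di ?filter_uniq //;
  last exact: uniq_roots.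
by rewrite big1 // => a; rewrite eq_sym; case: eqP.
Qed.

(** * Inertia of quadratic forms *)

Definition sqn (R : realType) (p : nat) (u : 'cV[R]_p) : R :=
  \sum_i u i 0 ^+ 2.

Lemma sqn_ge0 (R : realType) (p : nat) (u : 'cV[R]_p) : 0 <= sqn u.
Proof. by apply: sumr_ge0 => i _; apply: sqr_ge0. Qed.

Lemma sqn0 (R : realType) (p : nat) : sqn (0 : 'cV[R]_p) = 0.
Proof. by rewrite /sqn big1 // => i _; rewrite mxE expr0n. Qed.

Lemma sqn_le0 (R : realType) (p : nat) (u : 'cV[R]_p) : sqn u <= 0 -> u = 0.
Proof.
move=> u0; have /psumr_eq0P h : sqn u = 0 by apply/le_anti; rewrite u0 sqn_ge0.
apply/colP => i; rewrite mxE; apply/eqP; rewrite -sqrf_eq0.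
by apply/eqP/h => // j _; apply: sqr_ge0.
Qed.

Lemma linear_map0 (R : pzRingType) (U V : lmodType R) (f : U -> V) :
  linear f -> f 0 = 0.
Proof.
move=> lf; have := lf (- 1) 0 0.
by rewrite scaleN1r oppr0 addr0 scaleN1r addNr.
Qed.

Lemma linear_inj_leq (R : fieldType) (m n : nat) (f : 'cV[R]_m -> 'cV[R]_n) :
  linear f -> (forall u, f u = 0 -> u = 0) -> (m <= n)%N.
Proof.
move=> lf f0; pose g (u : 'rV[R]_m) : 'rV[R]_n := (f u^T)^T.
have lg : linear g by move=> a u v; rewrite /g !linearP /= lf linearP.
pose gL : {linear 'rV[R]_m -> 'rV[R]_n} :=
  HB.pack g (GRing.isLinear.Build _ _ _ _ g lg).
have : row_free (lin1_mx gL).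
  rewrite -kermx_eq0; apply/eqP/row_matrixP => i; rewrite row0.
  have : row i (kermx (lin1_mx gL)) *m lin1_mx gL = 0.
    by apply/sub_kermxP/row_sub.
  rewrite mul_rV_lin1 /= /g => /(congr1 trmx); rewrite trmxK trmx0 => /f0.
  by move/(congr1 trmx); rewrite trmxK trmx0.
by rewrite /row_free => /eqP <-; apply: rank_leq_col.
Qed.

(* The linear sections [hf] and [hg] say that (f, g) : V -> R^p x R^q is onto,
   i.e. that the squares are linearly independent. *)
Definition inertia (R : realType) (V : lmodType R) (Q : V -> R) (p q : nat) :=
  exists (f : V -> 'cV[R]_p) (g : V -> 'cV[R]_q)
    (hf : 'cV[R]_p -> V) (hg : 'cV[R]_q -> V),
    [/\ linear f, linear g, linear hf & linear hg] /\
    [/\ forall v, Q v = sqn (f v) - sqn (g v),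
        cancel hf f, forall a, g (hf a) = 0,
        cancel hg g & forall b, f (hg b) = 0].

Lemma inertia_opp (R : realType) (V : lmodType R) (Q : V -> R) (p q : nat) :
  inertia Q p q -> inertia (fun v => - Q v) q p.
Proof.
case=> f [g [hf [hg [[lf lg lhf lhg] [QE ff gf gg fg]]]]].
by exists g, f, hg, hf; split => //; split => // v; rewrite QE opprB.
Qed.

(** Sylvester's argument: on the image of [hg] the form is minus a sum of squares, whereas the
    second form is nonnegative where [g'] vanishes. Hence [g' \o phi \o hg] is injective, which
    bounds [q]; changing signs bounds [p]. *)
Lemma inertia_leq (R : realType) (V W : lmodType R) (Q : V -> R) (Q' : W -> R)
    (phi : V -> W) (p q p' q' : nat) :
  linear phi -> (forall v, Q v = Q' (phi v)) ->
  inertia Q p q -> inertia Q' p' q' -> (p <= p')%N && (q <= q')%N.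
Proof.
move=> lphi.
have neg (Q1 : V -> R) (Q2 : W -> R) p1 q1 p2 q2 :
    (forall v, Q1 v = Q2 (phi v)) ->
    inertia Q1 p1 q1 -> inertia Q2 p2 q2 -> (q1 <= q2)%N.
  move=> QE [f [g [hf [hg [[lf lg lhf lhg] [Q1E ff gf gg fg]]]]]].
  move=> [f' [g' [hf' [hg' [[lf' lg' _ _] [Q2E _ _ _ _]]]]]].
  apply: (@linear_inj_leq R q1 q2 (fun b => g' (phi (hg b)))) => [a u v|b gb].
    by rewrite lhg lphi lg'.
  apply: sqn_le0; rewrite -oppr_ge0.
  have := Q1E (hg b); rewrite fg gg sqn0 sub0r QE Q2E gb sqn0 subr0 => <-.
  exact: sqn_ge0.
move=> QE iQ iQ'; rewrite (neg Q Q' p q p' q') // andbT.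
apply: (neg (fun v => - Q v) (fun v => - Q' v) q p q' p').
- by move=> v; rewrite QE.
- exact: inertia_opp.
- exact: inertia_opp.
Qed.

(** Pulling back in both directions suffices, so the two spaces may have different dimensions, as
    they do in [inertia_split]. *)
Lemma inertia_eq (R : realType) (V W : lmodType R) (Q : V -> R) (Q' : W -> R)
    (phi : V -> W) (psi : W -> V) (p q p' q' : nat) :
  linear phi -> linear psi ->
  (forall v, Q v = Q' (phi v)) -> (forall v, Q' v = Q (psi v)) ->
  inertia Q p q -> inertia Q' p' q' -> p = p' /\ q = q'.
Proof.
move=> lphi lpsi E E' iQ iQ'.
have /andP [p1 q1] := inertia_leq lphi E iQ iQ'.
have /andP [p2 q2] := inertia_leq lpsi E' iQ' iQ.
by split; apply/eqP; rewrite eqn_leq ?p1 ?p2 ?q1 ?q2.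
Qed.

Lemma inertia_uniq (R : realType) (V : lmodType R) (Q : V -> R)
    (p q p' q' : nat) :
  inertia Q p q -> inertia Q p' q' -> p = p' /\ q = q'.
Proof. exact: (@inertia_eq R V V Q Q id id). Qed.

Lemma sqn_col_mx (R : realType) (p q : nat) (u : 'cV[R]_p) (v : 'cV[R]_q) :
  sqn (col_mx u v) = sqn u + sqn v.
Proof.
rewrite /sqn big_split_ord /=; congr (_ + _); apply: eq_bigr => i _.
  by rewrite col_mxEu.
by rewrite col_mxEd.
Qed.

Lemma inertia_sum (R : realType) (V W : lmodType R) (Q : V -> R) (Q' : W -> R)
    (p q p' q' : nat) :
  inertia Q p q -> inertia Q' p' q' ->
  inertia (fun v : V * W => Q v.1 + Q' v.2) (p + p') (q + q').
Proof.
case=> f [g [hf [hg [[lf lg lhf lhg] [QE ff gf gg fg]]]]].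
case=> f' [g' [hf' [hg' [[lf' lg' lhf' lhg'] [QE' ff' gf' gg' fg']]]]].
exists (fun v => col_mx (f v.1) (f' v.2)), (fun v => col_mx (g v.1) (g' v.2)).
exists (fun a => (hf (usubmx a), hf' (dsubmx a))).
exists (fun a => (hg (usubmx a), hg' (dsubmx a))).
split; split.
- by move=> a u v; rewrite /= lf lf' scale_col_mx add_col_mx.
- by move=> a u v; rewrite /= lg lg' scale_col_mx add_col_mx.
- by move=> a u v; rewrite !linearP /= lhf lhf'.
- by move=> a u v; rewrite !linearP /= lhg lhg'.
- by move=> v; rewrite QE QE' !sqn_col_mx opprD addrACA.
- by move=> a; rewrite /= ff ff' vsubmxK.
- by move=> a; rewrite /= gf gf' col_mx0.
- by move=> a; rewrite /= gg gg' vsubmxK.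
- by move=> a; rewrite /= fg fg' col_mx0.
Qed.

(** A rank factorization turns the form into the dot product of [C *m x.1] and [F *m x.2], to which
    the identity ab = ((a+b)/2)^2 - ((a-b)/2)^2 applies; the parameter [e] below is the sign 1 or
    -1. *)
Lemma inertia_hyperbolic (R : realType) (m n : nat) (L : 'M[R]_(m, n)) :
  inertia (fun x : 'cV[R]_m * 'cV[R]_n => (x.1^T *m L *m x.2) 0 0)
    (\rank L) (\rank L).
Proof.
set r := \rank L; pose C := (col_base L)^T; pose F := row_base L.
have LE : L = C^T *m F by rewrite trmxK mulmx_base.
have /row_freeP [C' CC'] : row_free C.
  by rewrite /row_free mxrank_tr; exact: col_base_full.
have /row_freeP [F' FF'] : row_free F by exact: row_base_free.
pose f e (x : 'cV[R]_m * 'cV[R]_n) := 2^-1 *: (C *m x.1 + e *: (F *m x.2)).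
pose h e (a : 'cV[R]_r) : 'cV[R]_m * 'cV[R]_n := (C' *m a, e *: (F' *m a)).
have lf e : linear (f e).
  move=> a u v; rewrite /f /= !mulmxDr -!scalemxAr.
  by apply/colP => i; rewrite ![in RHS]mxE ![in LHS]mxE; ring.
have lh e : linear (h e).
  move=> a u v; rewrite /h !mulmxDr -!scalemxAr !scalerDr !scalerA.
  by rewrite [e * a]mulrC -!scalerA.
have fh e e' a : f e (h e' a) = (2^-1 * (1 + e * e')) *: a.
  rewrite /f /h /= -scalemxAr !mulmxA CC' FF' !mul1mx scalerA.
  by rewrite -{1}[a]scale1r -scalerDl scalerA.
exists (f 1), (f (- 1)), (h 1), (h (- 1)); split; split => //.
- move=> [x y] /=; rewrite LE mulmxA -trmx_mul -mulmxA /f /=.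
  rewrite mxE /sqn -sumrB; apply: eq_bigr => i _; rewrite !mxE.
  by field.
- by move=> a; rewrite fh !mulr1 mulVf ?scale1r // pnatr_eq0.
- by move=> a; rewrite fh mulr1 subrr mulr0 scale0r.
- by move=> a; rewrite fh mulrNN !mulr1 mulVf ?scale1r // pnatr_eq0.
- by move=> a; rewrite fh mul1r subrr mulr0 scale0r.
Qed.

Lemma inertia_diagonal (R : realType) (V : lmodType R) (Q : V -> R) (N : nat)
    (d : 'I_N -> R) (x : V -> 'cV[R]_N) (y : 'cV[R]_N -> V) :
  linear x -> linear y -> cancel y x ->
  (forall v, Q v = \sum_i d i * x v i 0 ^+ 2) ->
  inertia Q #|[pred i | 0 < d i]| #|[pred i | d i < 0]|.
Proof.
move=> lx ly yK QE.
(* [F P] extracts the coordinates in [P], rescaled so that their squares absorb the coefficients;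
   [H P] undoes this, up to zero coefficients. *)
pose F (P : pred 'I_N) : 'M[R]_(#|P|, N) :=
  \matrix_(k, i) (Num.sqrt `|d i| *+ (enum_val k == i)).
pose H (P : pred 'I_N) : 'M[R]_(N, #|P|) :=
  \matrix_(i, k) ((Num.sqrt `|d i|)^-1 *+ (enum_val k == i)).
have FH (P P' : pred 'I_N) k k' : (F P *m H P') k k' =
    (enum_val k == enum_val k')%:R * (Num.sqrt `|d (enum_val k')|
       / Num.sqrt `|d (enum_val k')|).
  rewrite mxE (bigD1 (enum_val k')) //= !mxE eqxx mulr1n big1 ?addr0.
    by case: eqP => _; rewrite ?mul1r // !mul0r.
  by move=> i ne; rewrite !mxE [enum_val k' == i]eq_sym (negbTE ne) mulr0.
have sF (P : pred 'I_N) c : sqn (F P *m c) = \sum_(i | P i) `|d i| * c i 0 ^+ 2.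
  rewrite /sqn [RHS](@big_enum_val _ _ _ _ P); apply: eq_bigr => k _.
  rewrite mxE (bigD1 (enum_val k)) //= mxE eqxx mulr1n big1 ?addr0.
    by rewrite exprMn sqr_sqrtr.
  by move=> i ne; rewrite mxE eq_sym (negbTE ne) mul0r.
have FH1 (P : pred 'I_N) : (forall i, P i -> d i != 0) -> F P *m H P = 1%:M.
  move=> dP; apply/matrixP => k k'; rewrite FH mxE (inj_eq enum_val_inj).
  rewrite divff ?mulr1 // sqrtr_eq0 -ltNge normr_gt0; apply: dP.
  exact: (enum_valP k').
have FH0 (P P' : pred 'I_N) : (forall i, P i -> ~~ P' i) -> F P *m H P' = 0.
  move=> dP; apply/matrixP => k k'; rewrite FH mxE; case: eqP => [e|]; last first.
    by rewrite mul0r.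
  have := dP _ (enum_valP k); rewrite e.
  by rewrite (enum_valP k' : P' (enum_val k')).
set P := [pred i | 0 < d i]; set P' := [pred i | d i < 0].
have PN i : P i -> ~~ P' i by rewrite /= -leNgt => /ltW.
have PN' i : P' i -> ~~ P i by rewrite /= -leNgt => /ltW.
have Pd i : P i -> d i != 0 by move=> /lt0r_neq0.
have Pd' i : P' i -> d i != 0 by move=> /ltr0_neq0.
exists (fun v => F P *m x v), (fun v => F P' *m x v).
exists (fun a => y (H P *m a)), (fun a => y (H P' *m a)).
split; split.
- by move=> a u v; rewrite lx mulmxDr -scalemxAr.
- by move=> a u v; rewrite lx mulmxDr -scalemxAr.
- by move=> a u v; rewrite mulmxDr -scalemxAr ly.
- by move=> a u v; rewrite mulmxDr -scalemxAr ly.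
- move=> v; rewrite QE !sF [in RHS]big_mkcond [in X in _ - X]big_mkcond /= -sumrB.
  apply: eq_bigr => i _ /=; case: (ltgtP (d i) 0) => [di|di|->].
  + by rewrite ltr0_norm // mulNr opprK add0r.
  + by rewrite gtr0_norm // subr0.
  + by rewrite mul0r subr0.
- by move=> a; rewrite yK mulmxA FH1 // mul1mx.
- by move=> a; rewrite yK mulmxA FH0 // mul0mx.
- by move=> a; rewrite yK mulmxA FH1 // mul1mx.
- by move=> a; rewrite yK mulmxA FH0 // mul0mx.
Qed.

Lemma quad_diag (R : realType) (n : nat) (O : 'M[R]_n) (d : 'rV[R]_n)
    (u : 'cV[R]_n) :
  (u^T *m (O^T *m diag_mx d *m O) *m u) 0 0 = \sum_i d 0 i * (O *m u) i 0 ^+ 2.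
Proof.
rewrite !mulmxA -trmx_mul -(mulmxA _ O) mul_mx_diag mxE.
by apply: eq_bigr => i _; rewrite !mxE mulrAC mulrC.
Qed.

Lemma ind_opp_diagonal (R : realType) (n : nat) (A O : 'M[R]_n) (d : 'rV[R]_n) :
  O *m O^T = 1%:M -> A = O^T *m diag_mx d *m O ->
  ind (- A) = #|[pred i | 0 < d 0 i]|.
Proof.
move=> OO AE; rewrite (@ind_diagonal _ _ (- A) O (- d)) //.
  by apply: eq_card => i; rewrite !inE mxE oppr_lt0.
by rewrite AE raddfN /= mulmxN mulNmx.
Qed.

Lemma inertia_sym (R : realType) (n : nat) (A : 'M[R]_n) : A^T = A ->
  inertia (fun u : 'cV[R]_n => (u^T *m A *m u) 0 0) (ind (- A)) (ind A).
Proof.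
move=> /sym_diagonalizable [O [d [OO AE]]].
rewrite (ind_diagonal OO AE) (ind_opp_diagonal OO AE).
apply: (@inertia_diagonal _ _ _ n (d 0) (mulmx O) (mulmx O^T)).
- exact: linearP.
- exact: linearP.
- by move=> u; rewrite mulmxA OO mul1mx.
- by move=> u; rewrite AE quad_diag.
Qed.

Lemma rank_diag_mx (R : fieldType) (n : nat) (d : 'rV[R]_n) :
  \rank (diag_mx d) = #|[pred i | d 0 i != 0]|.
Proof.
rewrite -sum1_card big_mkcond /=.
elim: n d => [|n IH] d; first by rewrite big_ord0 flatmx0 mxrank0.
pose d' : 'rV[R]_(1 + n) := d.
have -> : \rank (diag_mx d)
    = (\rank (diag_mx (lsubmx d')) + \rank (diag_mx (rsubmx d')))%N.
  by rewrite -rank_diag_block_mx -diag_mx_row hsubmxK.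
rewrite IH.
rewrite big_ord_recl; congr (_ + _)%N.
  rewrite rank_rV (_ : diag_mx _ = (d 0 0)%:M).
    by rewrite inE -scalemx1 scaler_eq0 oner_eq0 orbF; case: eqP.
  by apply/matrixP => i j; rewrite !mxE !ord1 lshift0 eqxx mulr1n.
by apply: eq_bigr => i _; rewrite !inE !mxE rshift1.
Qed.

Lemma ind_rank (R : realType) (n : nat) (A : 'M[R]_n) : A^T = A ->
  (ind A + ind (- A))%N = \rank A.
Proof.
move=> /sym_diagonalizable [O [d [OO AE]]].
have OO' := mulmx1C OO; have [_ uO] := mulmx1_unit OO'.
rewrite (ind_diagonal OO AE) (ind_opp_diagonal OO AE).
rewrite {1}AE mxrankMfree ?row_free_unit // -mxrank_tr trmx_mul trmxK tr_diag_mx.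
rewrite mxrankMfree ?row_free_unit // rank_diag_mx -cardUI addnC.
rewrite (eq_card0 (A := [predI _ & _])) ?add0n; last first.
  by move=> i; rewrite !inE; case: ltgtP.
by apply: eq_card => i; rewrite !inE neq_lt.
Qed.

(** * Signature and inertia *)

Lemma is_signature_inertia (R : realType) (V : vectType R) (Q : V -> R)
    (s : int) :
  is_signature Q s -> exists p q, inertia Q p q /\ s = p%:Z - q%:Z.
Proof.
case=> N [e [d [be QE ->]]].
exists #|[pred i | 0 < d i]|, #|[pred i | d i < 0]|; split=> //.
apply: (@inertia_diagonal _ _ _ N d (fun v => \col_i coord e i v)
  (fun c => \sum_i c i 0 *: e`_i)).
- by move=> a u v; apply/colP => i; rewrite !mxE linearP.
- move=> a u v; rewrite scaler_sumr -big_split; apply: eq_bigr => i _.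
  by rewrite !mxE scalerDl scalerA.
- by move=> c; apply/colP => i; rewrite mxE coord_sum_free // (basis_free be).
- by move=> v; rewrite QE; apply: eq_bigr => i _; rewrite mxE.
Qed.

(** The form only sees the symmetric part [A] of [M]; the rows of an orthogonal matrix diagonalizing
    [A], transported by [y], form the required basis. *)
Lemma signature_exists (R : realType) (V : vectType R) (Q : V -> R) (N : nat)
    (x : V -> 'cV[R]_N) (y : 'cV[R]_N -> V) (M : 'M[R]_N) :
  linear x -> linear y -> cancel x y -> cancel y x ->
  (forall v, Q v = ((x v)^T *m M *m x v) 0 0) -> exists s, is_signature Q s.
Proof.
move=> lx ly xK yK QE; pose A := 2^-1 *: (M + M^T).
have AT : A^T = A by rewrite /A linearZ /= linearD /= trmxK addrC.
have QA v : Q v = ((x v)^T *m A *m x v) 0 0.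
  have tE : ((x v)^T *m M^T *m x v) 0 0 = Q v.
    have -> : (x v)^T *m M^T *m x v = ((x v)^T *m M *m x v)^T.
      by rewrite !trmx_mul trmxK mulmxA.
    by rewrite mxE QE.
  by rewrite /A -scalemxAr -scalemxAl mulmxDr mulmxDl 2!mxE tE -QE; field.
have [O [d [OO AE]]] := sym_diagonalizable AT.
have OO' := mulmx1C OO.
pose e := [tuple y (O^T *m delta_mx i 0) | i < N].
have en (i : 'I_N) : e`_i = y (O^T *m delta_mx i 0).
  by rewrite -tnth_nth tnth_mktuple.
have eE (c : 'I_N -> R) : \sum_i c i *: e`_i = y (O^T *m \col_i c i).
  pose z (u : 'cV[R]_N) := y (O^T *m u).
  have lz : linear z by move=> a u v; rewrite /z mulmxDr -scalemxAr ly.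
  pose zL : {linear 'cV[R]_N -> V} :=
    HB.pack z (GRing.isLinear.Build _ _ _ _ z lz).
  rewrite -[y _]/(zL _) [\col_i c i]matrix_sum_delta linear_sum.
  by apply: eq_bigr => i _; rewrite big_ord1 linearZ /= mxE en.
have fe : free e.
  apply/freeP => k h i; move: (eE k); rewrite h => /(congr1 x).
  rewrite yK (linear_map0 lx) => /(congr1 (mulmx O)).
  by rewrite mulmx0 mulmxA OO mul1mx => /colP /(_ i); rewrite !mxE.
have ve v : v = \sum_i (O *m x v) i 0 *: e`_i.
  rewrite eE; have -> : \col_i (O *m x v) i 0 = O *m x v.
    by apply/colP => i; rewrite mxE.
  by rewrite mulmxA OO' mul1mx xK.
have be : basis_of fullv e.
  rewrite basisEfree fe subvf /= -[X in (_ <= X)%N](eqP fe) dimvS //.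
  by apply/subvP => v _; rewrite (ve v) memv_suml // => i _; rewrite memvZ //
    memv_span // mem_nth // size_tuple.
have ce v i : coord e i v = (O *m x v) i 0.
  by rewrite {1}(ve v) coord_sum_free.
exists (#|[pred i | 0 < d 0 i]|%:Z - #|[pred i | d 0 i < 0]|%:Z).
exists N, e, (d 0); split => // v.
by rewrite QA AE quad_diag; apply: eq_bigr => i _; rewrite ce.
Qed.

(** Existence rules out the default value 0 of [xget], so [signature Q] is a genuine signature; it
    comes from some inertia, and the inertia is unique. *)
Lemma signature_inertia (R : realType) (V : vectType R) (Q : V -> R) (N : nat)
    (x : V -> 'cV[R]_N) (y : 'cV[R]_N -> V) (M : 'M[R]_N) (p q : nat) :
  linear x -> linear y -> cancel x y -> cancel y x ->
  (forall v, Q v = ((x v)^T *m M *m x v) 0 0) ->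
  inertia Q p q -> signature Q = p%:Z - q%:Z.
Proof.
move=> lx ly xK yK QE iQ.
have [s hs] := signature_exists lx ly xK yK QE.
have : is_signature Q (signature Q).
  by rewrite /signature; case: xgetP => [z _ //|/(_ s)].
move=> /is_signature_inertia [p' [q' [iQ' ->]]].
by have [-> ->] := inertia_uniq iQ iQ'.
Qed.

(** * Kashiwara forms in graph coordinates *)

Definition bform (R : realType) (m n : nat) (M : 'M[R]_(m, n)) (u : 'cV[R]_m)
  (v : 'cV[R]_n) : R := (u^T *m M *m v) 0 0.

Lemma bformDl (R : realType) (m n : nat) (M : 'M[R]_(m, n)) u u' v :
  bform M (u + u') v = bform M u v + bform M u' v.
Proof. by rewrite /bform linearD /= !mulmxDl mxE. Qed.

Lemma bformDr (R : realType) (m n : nat) (M : 'M[R]_(m, n)) u v v' :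
  bform M u (v + v') = bform M u v + bform M u v'.
Proof. by rewrite /bform mulmxDr mxE. Qed.

Lemma bformNr (R : realType) (m n : nat) (M : 'M[R]_(m, n)) u v :
  bform M u (- v) = - bform M u v.
Proof. by rewrite /bform mulmxN mxE. Qed.

Lemma bformMD (R : realType) (m n : nat) (M M' : 'M[R]_(m, n)) u v :
  bform (M + M') u v = bform M u v + bform M' u v.
Proof. by rewrite /bform mulmxDr mulmxDl mxE. Qed.

Lemma bformMN (R : realType) (m n : nat) (M : 'M[R]_(m, n)) u v :
  bform (- M) u v = - bform M u v.
Proof. by rewrite /bform mulmxN mulNmx mxE. Qed.

Lemma bform_tr (R : realType) (m n : nat) (M : 'M[R]_(m, n)) u v :
  bform M^T v u = bform M u v.
Proof.
have -> : bform M u v = (u^T *m M *m v)^T 0 0 by rewrite mxE.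
by rewrite !trmx_mul trmxK mulmxA.
Qed.

Lemma bform_mull (R : realType) (m n p : nat) (M : 'M[R]_(m, n))
    (A : 'M[R]_(m, p)) u v :
  bform M (A *m u) v = bform (A^T *m M) u v.
Proof. by rewrite /bform trmx_mul !mulmxA. Qed.

Lemma bform_mulr (R : realType) (m n p : nat) (M : 'M[R]_(m, n))
    (A : 'M[R]_(n, p)) u v :
  bform M u (A *m v) = bform (M *m A) u v.
Proof. by rewrite /bform !mulmxA. Qed.

Lemma inertia_iso (R : realType) (V W : lmodType R) (Q : V -> R) (Q' : W -> R)
    (phi : V -> W) (psi : W -> V) (p q : nat) :
  linear phi -> linear psi -> cancel psi phi ->
  (forall v, Q v = Q' (phi v)) -> inertia Q' p q -> inertia Q p q.
Proof.
move=> lphi lpsi psiK QE.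
case=> f [g [hf [hg [[lf lg lhf lhg] [Q'E ff gf gg fg]]]]].
exists (f \o phi), (g \o phi), (psi \o hf), (psi \o hg); split; split => /=.
- by move=> a u v /=; rewrite lphi lf.
- by move=> a u v /=; rewrite lphi lg.
- by move=> a u v /=; rewrite lhf lpsi.
- by move=> a u v /=; rewrite lhg lpsi.
- by move=> v; rewrite QE Q'E.
- by move=> a /=; rewrite psiK ff.
- by move=> a /=; rewrite psiK gf.
- by move=> a /=; rewrite psiK gg.
- by move=> a /=; rewrite psiK fg.
Qed.

(** The shape of a Kashiwara form in coordinates. The matrices are arbitrary, so that it covers both
    the values of [w] on frames and the differences of slopes. *)
Definition cycform (R : realType) (n : nat) (a b c : 'M[R]_n)
    (u : 'cV[R]_n * 'cV[R]_n * 'cV[R]_n) : R :=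
  bform a u.1.1 u.1.2 + bform b u.1.2 u.2 + bform c u.2 u.1.1.

(* With u1 = y3 + y2, u2 = y3 + y1, u3 = y1 + y2 the cyclic form becomes
   a(y3, y3) + b(y1, y1) + c(y2, y2), the mixed terms having the coefficient
   a + b + c. *)
Lemma inertia_cycform (R : realType) (n : nat) (a b c : 'M[R]_n) :
  a^T = a -> b^T = b -> c^T = c -> a + b + c = 0 ->
  inertia (cycform a b c)
    (ind (- a) + ind (- b) + ind (- c)) (ind a + ind b + ind c).
Proof.
move=> aT bT cT abc.
have iS := inertia_sum (inertia_sum (inertia_sym aT) (inertia_sym bT))
  (inertia_sym cT).
pose h : R := 2^-1.
pose phi (u : 'cV[R]_n * 'cV[R]_n * 'cV[R]_n) :=
  (h *: (u.1.1 + u.1.2 - u.2), h *: (u.1.2 + u.2 - u.1.1),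
   h *: (u.2 + u.1.1 - u.1.2)).
pose psi (y : 'cV[R]_n * 'cV[R]_n * 'cV[R]_n) :=
  (y.1.1 + y.2, y.1.1 + y.1.2, y.1.2 + y.2).
have psiK : cancel psi phi.
  by case=> [[y1 y2] y3]; congr (_, _, _); apply/colP => i; rewrite !mxE /h /=;
    field.
have phiK : cancel phi psi.
  by case=> [[y1 y2] y3]; congr (_, _, _); apply/colP => i; rewrite !mxE /h /=;
    field.
apply: (inertia_iso (phi := phi) (psi := psi)) iS => //.
- move=> k [[u1 u2] u3] [[v1 v2] v3].
  by congr (_, _, _); apply/colP => i; rewrite !mxE; ring.
- move=> k [[u1 u2] u3] [[v1 v2] v3].
  by congr (_, _, _); apply/colP => i; rewrite !mxE; ring.
move=> u; rewrite -{1}(phiK u); move: (phi u) => {u} [[y3 y1] y2] /=.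
rewrite -![(_^T *m _ *m _) 0 0]/(bform _ _ _) /cycform /=.
have sa u v : bform a u v = bform a v u by rewrite -{1}aT bform_tr.
have sb u v : bform b u v = bform b v u by rewrite -{1}bT bform_tr.
have cE : c = - (a + b) by apply/esym/eqP; rewrite eqr_oppLR -addr_eq0 abc.
rewrite !(bformDl, bformDr) cE !(bformMN, bformMD).
rewrite (sa y2 y1) (sa y3 y1) (sb y2 y3) (sb y3 y1).
by ring.
Qed.

(** * The symplectic form on frames and slope coordinates *)

Definition vertical (R : realType) (n : nat) : 'M[R]_(n + n, n) :=
  col_mx 0 1%:M.

Definition kform (R : realType) (n : nat) (Y1 Y2 Y3 : 'M[R]_(n + n, n)) :=
  cycform (w Y1 Y2) (w Y2 Y3) (w Y3 Y1).

Lemma wE (R : realType) (n p q : nat) (Y : 'M[R]_(n + n, p))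
    (Z : 'M[R]_(n + n, q)) :
  w Y Z = (usubmx Y)^T *m dsubmx Z - (dsubmx Y)^T *m usubmx Z.
Proof.
rewrite /w /sympJ -{1}(vsubmxK Y) -{1}(vsubmxK Z) tr_col_mx mul_row_block.
by rewrite !mulmx0 mulmx1 mulmxN mulmx1 add0r addr0 mul_row_col mulNmx addrC.
Qed.

Lemma w_tr (R : realType) (n p q : nat) (Y : 'M[R]_(n + n, p))
    (Z : 'M[R]_(n + n, q)) :
  (w Y Z)^T = - w Z Y.
Proof. by rewrite !wE linearB /= !trmx_mul !trmxK opprB. Qed.

Lemma w_vertical (R : realType) (n p : nat) (Y : 'M[R]_(n + n, p)) :
  w (vertical R n) Y = - usubmx Y.
Proof. by rewrite wE /vertical col_mxKu col_mxKd trmx0 trmx1 mul0mx mul1mx sub0r. Qed.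

Lemma w_vertical_r (R : realType) (n p : nat) (Y : 'M[R]_(n + n, p)) :
  w Y (vertical R n) = (usubmx Y)^T.
Proof. by apply: trmx_inj; rewrite w_tr w_vertical opprK trmxK. Qed.

(** This is [w (col_mx 1%:M t%:M) Y], so it is invertible exactly when the span of [Y] is transverse
    to the Lagrangian {(x, t x)}. *)
Definition slope_den (R : realType) (n : nat) (t : R) (Y : 'M[R]_(n + n, n)) :=
  dsubmx Y - t *: usubmx Y.

(* When the denominator is invertible, Y spans the graph of this symmetric
   matrix over the vertical subspace along the Lagrangian {(x, t x)}. *)
Definition slope (R : realType) (n : nat) (t : R) (Y : 'M[R]_(n + n, n)) :=
  usubmx Y *m invmx (slope_den t Y).

Lemma frame_sym (R : realType) (n : nat) (Y : 'M[R]_(n + n, n)) :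
  w Y Y = 0 -> (usubmx Y)^T *m dsubmx Y = (dsubmx Y)^T *m usubmx Y.
Proof. by rewrite wE => /subr0_eq. Qed.

Section Slopes.
Variables (R : realType) (n : nat) (t : R).
Implicit Types Y Z : 'M[R]_(n + n, n).

Let good Y := w Y Y = 0 /\ slope_den t Y \in unitmx.

Lemma slope_den_tr Y :
  (slope_den t Y)^T = (dsubmx Y)^T - t *: (usubmx Y)^T.
Proof. by apply/matrixP => i j; rewrite !mxE. Qed.

Lemma slopeK Y : good Y -> slope t Y *m slope_den t Y = usubmx Y.
Proof. by case=> _ uY; rewrite /slope mulmxKV. Qed.

(** Isotropy makes X^T (U - t X) symmetric, and multiplying by the inverse of U - t X on the right
    and of its transpose on the left gives the slope. *)
Lemma slope_sym Y : good Y -> (slope t Y)^T = slope t Y.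
Proof.
case=> wY uY; have XC : (usubmx Y)^T *m slope_den t Y
    = (slope_den t Y)^T *m usubmx Y.
  rewrite slope_den_tr /slope_den mulmxBr mulmxBl frame_sym //.
  by rewrite -scalemxAr -scalemxAl.
rewrite /slope trmx_mul trmx_inv.
apply: (canLR (mulKmx _)); first by rewrite unitmx_tr.
by rewrite mulmxA -XC mulmxK.
Qed.

(** The terms in [t] cancel when U is replaced by U - t X in both frames; then X is the slope times
    [slope_den]. *)
Lemma w_slope Y Z : good Y -> good Z ->
  w Y Z = (slope_den t Y)^T *m (slope t Y - slope t Z) *m slope_den t Z.
Proof.
move=> gY gZ; rewrite [_ *m (slope t Y - _)]mulmxBr mulmxBl.
rewrite -(mulmxA _ (slope t Z)) slopeK //.
have -> : (slope_den t Y)^T *m slope t Y = (usubmx Y)^T.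
  by rewrite -[slope t Y in LHS](slope_sym gY) -trmx_mul slopeK.
rewrite wE slope_den_tr /slope_den mulmxBr mulmxBl.
by rewrite -scalemxAr -scalemxAl opprB addrA subrK.
Qed.

Lemma rank_w_slope Y Z : good Y -> good Z ->
  \rank (w Y Z) = \rank (slope t Y - slope t Z).
Proof.
move=> gY gZ; rewrite w_slope // mxrankMfree ?row_free_unit ?gZ.2 //.
rewrite -mxrank_tr trmx_mul trmxK mxrankMfree ?row_free_unit ?gY.2 //.
by rewrite mxrank_tr.
Qed.

Lemma rank_slope Y : good Y -> \rank (slope t Y) = \rank (usubmx Y).
Proof.
by move=> gY; rewrite -[in RHS](slopeK gY) [RHS]mxrankMfree ?row_free_unit ?gY.2.
Qed.

Lemma good_vertical : good (vertical R n).
Proof.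
split; first by rewrite w_vertical /vertical col_mxKu oppr0.
by rewrite /slope_den /vertical col_mxKu col_mxKd scaler0 subr0 unitmx1.
Qed.

Lemma slope_vertical : slope t (vertical R n) = 0.
Proof. by rewrite /slope /vertical col_mxKu mul0mx. Qed.

(** Changing variables by the three invertible [slope_den] leaves the cyclic form of the slope
    differences, whose sum is 0. *)
Lemma inertia_kform Y1 Y2 Y3 : good Y1 -> good Y2 -> good Y3 ->
  let a := slope t Y1 - slope t Y2 in
  let b := slope t Y2 - slope t Y3 in
  let c := slope t Y3 - slope t Y1 in
  inertia (kform Y1 Y2 Y3)
    (ind (- a) + ind (- b) + ind (- c)) (ind a + ind b + ind c).
Proof.
move=> g1 g2 g3 a b c.
have iabc : inertia (cycform a b c)
    (ind (- a) + ind (- b) + ind (- c)) (ind a + ind b + ind c).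
  apply: inertia_cycform; rewrite /a /b /c ?linearB /= ?slope_sym //.
  by rewrite !subrKA subrr.
pose phi (A1 A2 A3 : 'M[R]_n) (u : 'cV[R]_n * 'cV[R]_n * 'cV[R]_n) :=
  (A1 *m u.1.1, A2 *m u.1.2, A3 *m u.2).
have lphi A1 A2 A3 : linear (phi A1 A2 A3).
  by move=> k u v; rewrite /phi /= !mulmxDr -!scalemxAr.
apply: (inertia_iso (phi := phi (slope_den t Y1) (slope_den t Y2) (slope_den t Y3))
  (psi := phi (invmx (slope_den t Y1)) (invmx (slope_den t Y2))
     (invmx (slope_den t Y3)))) iabc => //.
- case=> [[u1 u2] u3]; rewrite /phi /= !mulmxA !mulmxV ?mul1mx //.
  + exact: g3.2.
  + exact: g2.2.
  + exact: g1.2.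
- case=> [[u1 u2] u3]; rewrite /kform /cycform /phi /=.
  by rewrite !(bform_mulr, bform_mull) mulmxA -!w_slope // !mulmxA -!w_slope.
Qed.

End Slopes.

(** * Comparative index *)

Lemma frame_gram_unit (R : realType) (n : nat) (Y : 'M[R]_(n + n, n)) :
  \rank Y = n ->
  (usubmx Y)^T *m usubmx Y + (dsubmx Y)^T *m dsubmx Y \in unitmx.
Proof.
move=> rY; rewrite -mul_row_col -tr_col_mx vsubmxK.
rewrite -[X in _ *m X]trmxK; apply: row_free_gram.
by rewrite /row_free mxrank_tr rY.
Qed.

(* [Y *m S *m Y^T] projects orthogonally onto the Lagrangian subspace, whose
   orthogonal complement is its image under J. *)
Lemma frame_projector (R : realType) (n : nat) (Y : 'M[R]_(n + n, n)) :
  is_frame Y ->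
  let X := usubmx Y in let U := dsubmx Y in
  exists S : 'M[R]_n, X *m S *m X^T + U *m S *m U^T = 1%:M /\
    X *m S *m U^T = U *m S *m X^T.
Proof.
move=> [wY rY] X U.
have XU : X^T *m U = U^T *m X by exact: frame_sym.
pose S := X^T *m X + U^T *m U.
have uS : S \in unitmx by exact: frame_gram_unit.
(* The columns of [G] are those of [Y] followed by their images under J, and [Gt] is its transpose.
   The left inverse [H *m Gt] is also a right inverse, and the upper blocks of that identity are the
   two claims. *)
pose G := block_mx X U U (- X); pose H := block_mx (invmx S) 0 0 (invmx S).
pose Gt := block_mx X^T U^T U^T (- X^T).
have HG : H *m Gt *m G = 1%:M.
  rewrite -mulmxA /Gt /G mulmx_block !mulmxN !mulNmx XU subrr opprK.
  rewrite [U^T *m U + _]addrC -/S /H mulmx_block !mulmx0 !mul0mx.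
  by rewrite !addr0 add0r mulVmx // -scalar_mx_block.
have := mulmx1C HG; rewrite mulmxA /G /H mulmx_block !mulmx0 !addr0 !add0r.
rewrite /Gt mulmx_block scalar_mx_block => /eq_block_mx [e1 e2 _ _].
by exists (invmx S); split => //; apply/subr0_eq; rewrite -mulmxN.
Qed.

(* The substitution y = y' + A z, v = v' - S1 y - S2 z turns
   v.(X' z - X y) + y.(W z) into v'.L(y', z) + z.(P z), where L(y', z) depends
   on z only through (1 - T) z and z.(P z) only through T z. *)
Section SplitForm.
Variables (R : realType) (n : nat) (X X' W D T F P : 'M[R]_n).
Hypotheses (DXT : (D *m X)^T = D *m X) (TT : T *m T = T) (Tsym : T^T = T).
Hypotheses (WT : W *m T = D *m X *m (W *m T)) (XDXT : X *m D *m X' *m T = X' *m T).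
Hypotheses (FX : F *m X = 0) (FX' : F *m X' = 1%:M - T).
Hypotheses (PE : P = T *m W^T *m D *m X' *m T) (Psym : P^T = P).

Variables (L : 'M[R]_(n, n + n)) (A S1 S2 : 'M[R]_n).
Hypotheses (LE : L = row_mx (- X) (X' *m (1%:M - T))) (AE : A = D *m X' *m T).
Hypotheses (S1E : S1^T = W *m F).
Hypotheses (S2E : S2^T = T *m W^T *m D *m (X' *m F - 1%:M)).

Let T1sym : (1%:M - T)^T = 1%:M - T.
Proof. by rewrite linearB /= trmx1 Tsym. Qed.

Let T1T : (1%:M - T) *m T = 0.
Proof. by rewrite mulmxBl mul1mx TT subrr. Qed.

Let T1T1 : (1%:M - T) *m (1%:M - T) = 1%:M - T.
Proof. by rewrite mulmxBr mulmx1 T1T subr0. Qed.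

(** Right multiplication by [F^T] kills [X^T] and sends [B] to [1%:M - T]. So the row spaces of
    [X^T] and [B] meet trivially, and [B] has the rank of [1%:M - T]. *)
Let rankL : \rank L = (\rank X + \rank (1%:M - T)%R)%N.
Proof.
pose B := (1%:M - T) *m X'^T.
have BF : B *m F^T = 1%:M - T by rewrite /B -mulmxA -trmx_mul FX' T1sym T1T1.
have XF : X^T *m F^T = 0 by rewrite -trmx_mul FX trmx0.
have XB0 : (X^T :&: B = 0)%MS.
  apply/eqP; rewrite -submx0; apply/rV_subP => u.
  rewrite sub_capmx => /andP [/submxP [a ua] /submxP [b ub]].
  have b0 : b *m (1%:M - T) = 0.
    by rewrite -BF mulmxA -ub ua -mulmxA XF mulmx0.
  by rewrite ub /B mulmxA b0 mul0mx sub0mx.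
have rB : \rank B = \rank (1%:M - T)%R.
  by apply/eqP; rewrite eqn_leq mxrankM_maxl /= -{1}BF mxrankM_maxl.
have -> : \rank L = \rank (X^T + B)%MS.
  rewrite -mxrank_tr LE tr_row_mx trmx_mul T1sym linearN /= -addsmxE.
  by rewrite (adds_eqmx (eqmx_opp _) (eqmx_refl B)).
by rewrite mxrank_disjoint_sum // rB mxrank_tr.
Qed.

(** In the expansion of v'.L(y', z), [S1] supplies y.(W (1 - T) z), while [S2] supplies y.(W T z)
    together with -z.(P z), which the separate term in [P] cancels. *)
Let S1X : S1^T *m X = 0. Proof. by rewrite S1E -mulmxA FX mulmx0. Qed.

Let S1X' : S1^T *m X' = W *m (1%:M - T).
Proof. by rewrite S1E -mulmxA FX'. Qed.

Let S2X : S2^T *m X = - (W *m T)^T.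
Proof.
rewrite S2E -mulmxA mulmxBl -(mulmxA X') FX mulmx0 mul1mx sub0r mulmxN.
by rewrite WT [in RHS]trmx_mul DXT trmx_mul Tsym !mulmxA.
Qed.

Let S2X' : S2^T *m X' = - P.
Proof.
rewrite S2E -mulmxA mulmxBl -(mulmxA X') FX' mul1mx.
rewrite [X' *m (_ - _)]mulmxBr mulmx1 [_ - X']addrC addKr.
by rewrite mulmxN PE !mulmxA.
Qed.

(** The argument of [P] is made independent of the one in [L], so that the form is a direct sum; the
    price is n extra dimensions. *)
Let split_form (u : 'cV[R]_n * 'cV[R]_(n + n) * 'cV[R]_n) :=
  bform L u.1.1 u.1.2 + bform P u.2 u.2.

Let phi (u : 'cV[R]_n * 'cV[R]_n * 'cV[R]_n) :=
  (u.1.1 + S1 *m u.1.2 + S2 *m u.2, col_mx (u.1.2 - A *m u.2) u.2, u.2).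

(** The two copies of z are glued: the (1 - T) part comes from the copy seen by [L], the T part from
    the copy seen by [P]. Both forms keep their values, although [phi] and [psi] are not inverse to
    each other. *)
Let psi (u : 'cV[R]_n * 'cV[R]_(n + n) * 'cV[R]_n) :=
  let z := (1%:M - T) *m dsubmx u.1.2 + T *m u.2 in
  let y := usubmx u.1.2 + A *m u.2 in
  (u.1.1 - S1 *m y - S2 *m z, y, z).

Let mulL (y z : 'cV[R]_n) :
  L *m col_mx y z = X' *m ((1%:M - T) *m z) - X *m y.
Proof. by rewrite LE mul_row_col mulNmx addrC mulmxA. Qed.

Let cyc_phi u : cycform (- X) W X'^T u = split_form (phi u).
Proof.
case: u => [[v y] z]; rewrite /cycform /split_form /phi /=.
rewrite bform_tr.
have -> : bform L (v + S1 *m y + S2 *m z) (col_mx (y - A *m z) z)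
    = bform 1%:M (v + S1 *m y + S2 *m z) (X' *m z - X *m y).
  rewrite -[L]mul1mx -bform_mulr mulL; congr bform.
  rewrite mulmxBr [(1%:M - T) *m z]mulmxBl mul1mx mulmxBr !mulmxA AE !mulmxA XDXT.
  by rewrite opprB addrA subrK.
rewrite !(bformDl, bformDr, bformNr) !bform_mulr !bform_mull !mulmxA !mulmx1.
rewrite !mul1mx S1X S1X' S2X S2X' !bformMN bform_tr.
rewrite mulmxBr mulmx1 bformMD bformMN.
have -> : bform 0 y y = 0 by rewrite /bform mulmx0 mul0mx mxE.
by ring.
Qed.

Let split_form_psi u : split_form u = cycform (- X) W X'^T (psi u).
Proof.
rewrite cyc_phi; case: u => [[v c] s]; rewrite /psi /=.
set z := (1%:M - T) *m dsubmx c + T *m s; set y := usubmx c + A *m s.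
have Tz : T *m z = T *m s.
  by rewrite /z mulmxDr !mulmxA mulmxBr mulmx1 TT subrr mul0mx add0r.
have Az : A *m z = A *m s by rewrite AE -!(mulmxA _ T) Tz.
have Pz : bform P z z = bform P s s.
  have -> : P = T^T *m (W^T *m D *m X') *m T by rewrite Tsym PE !mulmxA.
  by rewrite -bform_mulr -bform_mull Tz bform_mull bform_mulr.
have yA : y - A *m s = usubmx c by rewrite /y addrK.
rewrite /split_form /phi /= Pz Az yA [_ - _ + S1 *m _]addrAC !subrK.
congr (_ + _).
rewrite -{1}(vsubmxK c) -[L]mul1mx -!bform_mulr !mulL.
congr (bform _ _ (X' *m _ - _)).
by rewrite [RHS]mulmxBl mul1mx Tz /z addrK.
Qed.

Lemma inertia_split p q : inertia (cycform (- X) W X'^T) p q ->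
  p = (\rank X + \rank (1%:M - T)%R + ind (- P))%N /\
  q = (\rank X + \rank (1%:M - T)%R + ind P)%N.
Proof.
move=> iK; have iS := inertia_sum (inertia_hyperbolic L) (inertia_sym Psym).
rewrite -rankL.
apply: (inertia_eq (phi := phi) (psi := psi) _ _ cyc_phi split_form_psi iK iS).
- move=> a [[u1 u2] u3] [[v1 v2] v3]; congr (_, _, _) => /=.
    by rewrite !mulmxDr -!scalemxAr; apply/colP => i; rewrite ![in RHS]mxE
      ![in LHS]mxE; ring.
  rewrite scale_col_mx add_col_mx; congr col_mx.
  by rewrite !mulmxDr -!scalemxAr; apply/colP => i; rewrite ![in RHS]mxE
    ![in LHS]mxE; ring.
- move=> a [[u1 u2] u3] [[v1 v2] v3]; congr (_, _, _) => /=;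
  rewrite !linearP /= ?(mulmxDr, linearP) /= -?scalemxAr;
  by apply/colP => i; rewrite ![in RHS]mxE ![in LHS]mxE; ring.
Qed.

End SplitForm.

Section ComparativeIndex.
Variables (R : realType) (n : nat) (Y Z : 'M[R]_(n + n, n)).
Hypotheses (frY : is_frame Y) (frZ : is_frame Z).

Let X := usubmx Y.
Let U := dsubmx Y.
Let X' := usubmx Z.
Let U' := dsubmx Z.
Let W := w Y Z.
Let D := mpinv X.
Let M := ciM Y Z.
Let T := ciT Y Z.
Let P := ciP Y Z.
Let K := 1%:M - D *m X.
(** Chosen so that [F *m X = 0] and [F *m X' = 1%:M - T]: [K] kills X^T, whence K U^T X = K X^T U =
    0 and K U^T X' = - M. *)
Let F := - (mpinv M *m K *m U^T).

Let XU : X^T *m U = U^T *m X. Proof. by apply: frame_sym; case: frY. Qed.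
Let XU' : X'^T *m U' = U'^T *m X'. Proof. by apply: frame_sym; case: frZ. Qed.
Let WE : W = X^T *m U' - U^T *m X'. Proof. exact: wE. Qed.

Let XDX : X *m D *m X = X. Proof. by case/and4P: (mpinvP X) => /eqP. Qed.
Let DXT : (D *m X)^T = D *m X. Proof. by case/and4P: (mpinvP X) => _ _ _ /eqP. Qed.
Let MNM : M *m mpinv M *m M = M. Proof. by case/and4P: (mpinvP M) => /eqP. Qed.
Let NMT : (mpinv M *m M)^T = mpinv M *m M.
Proof. by case/and4P: (mpinvP M) => _ _ _ /eqP. Qed.
Let KX : K *m X^T = 0.
Proof.
apply: trmx_inj; rewrite trmx_mul trmxK trmx0 /K [(_ - _)^T]linearB /= trmx1.
by rewrite DXT mulmxBr mulmx1 mulmxA XDX subrr.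
Qed.

Let KW : K *m W = - (K *m U^T *m X').
Proof. by rewrite WE mulmxBr !mulmxA KX mul0mx sub0r. Qed.

Let T1 : 1%:M - T = mpinv M *m M. Proof. by rewrite /T /ciT opprB addrC subrK. Qed.
Let MT : M *m T = 0.
Proof. by rewrite /T /ciT mulmxBr mulmx1 mulmxA MNM subrr. Qed.
Let TT : T *m T = T.
Proof.
rewrite {1}/T /ciT mulmxBl mul1mx -mulmxA -[ciM Y Z]/M.
by rewrite MT mulmx0 subr0.
Qed.
Let Tsym : T^T = T.
Proof. by rewrite /T /ciT [(_ - _)^T]linearB /= trmx1 NMT. Qed.

Let WT : W *m T = D *m X *m (W *m T).
Proof.
by apply/subr0_eq; rewrite -{1}[W *m T]mul1mx -mulmxBl mulmxA; exact: MT.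
Qed.

(** The columns of X' T lie in the range of X. By [frame_projector], the projector [N] along this
    range factors through K U^T, and K U^T X' T = - M T = 0. *)
Let XDXT : X *m D *m X' *m T = X' *m T.
Proof.
have [S [S1 S2]] := frame_projector frY; rewrite -/X -/U in S1 S2.
pose N := 1%:M - X *m D.
have NX : N *m X = 0 by rewrite /N mulmxBl mul1mx XDX subrr.
have NE : N = N *m U *m S *m U^T.
  by rewrite -{1}[N]mulmx1 -S1 mulmxDr !mulmxA NX !mul0mx add0r.
have NUSX : N *m U *m S *m X^T = 0.
  by rewrite -!mulmxA [U *m _]mulmxA -S2 !mulmxA NX !mul0mx.
have NUSK : N *m U *m S = N *m U *m S *m K.
  by rewrite mulmxBr mulmx1 -DXT trmx_mul mulmxA NUSX mul0mx subr0.
have KUXT : K *m U^T *m X' *m T = 0.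
  have := MT; rewrite /M /ciM -/X -/D -/K -/W KW mulNmx.
  by move/(congr1 -%R); rewrite opprK oppr0.
have : N *m X' *m T = 0.
  by rewrite NE NUSK -!mulmxA (mulmxA K) (mulmxA (K *m _)) KUXT !mulmx0.
by rewrite /N !mulmxBl mul1mx => /subr0_eq/esym.
Qed.

Let FX : F *m X = 0.
Proof. by rewrite /F mulNmx -!mulmxA -XU (mulmxA K) KX mul0mx mulmx0 oppr0. Qed.

Let FX' : F *m X' = 1%:M - T.
Proof.
by rewrite T1 /F mulNmx -!mulmxA (mulmxA K) -mulmxN -KW.
Qed.

Let T1T1 : (1%:M - T) *m (1%:M - T) = 1%:M - T.
Proof. by rewrite mulmxBl mul1mx mulmxBr mulmx1 TT subrr subr0. Qed.

(** With [A] satisfying X A = X' T, the matrix P becomes a difference of congruent images of U'^T X'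
    and X^T U, both symmetric because the frames are isotropic. *)
Lemma ciP_sym : P^T = P.
Proof.
pose A := D *m X' *m T.
have XA : X *m A = X' *m T by rewrite /A !mulmxA.
have PE : P = T *m (U'^T *m X') *m T - A^T *m (X^T *m U) *m A.
  have -> : P = T *m W^T *m A by rewrite /P /ciP /A !mulmxA.
  have -> : W^T = U'^T *m X - X'^T *m U.
    by rewrite WE [(_ - _)^T]linearB /= !trmx_mul !trmxK.
  have TX' : T *m X'^T = A^T *m X^T.
    by rewrite -[RHS]trmx_mul XA trmx_mul Tsym.
  by rewrite mulmxBr mulmxBl -!mulmxA XA !mulmxA TX'.
rewrite PE [(_ - _)^T]linearB /= !trmx_mul !trmxK Tsym -XU' -XU.
by rewrite !mulmxA.
Qed.

Lemma inertia_kform_vertical p q :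
  inertia (kform (vertical R n) Y Z) p q ->
  p = (\rank (usubmx Y) + mu_star Y Z)%N /\ q = (\rank (usubmx Y) + mu Y Z)%N.
Proof.
rewrite /kform w_vertical w_vertical_r => iK.
(* Here [1%:M - T] is [mpinv M *m M], so the rank occurring in [inertia_split] is the one in the
   definition of the comparative index. *)
have rT : \rank (1%:M - T)%R = \rank M.
  apply/eqP; rewrite eqn_leq T1 mxrankM_maxr /=.
  by rewrite -{1}MNM -mulmxA mxrankM_maxr.
rewrite /mu_star /mu !addnA -rT.
apply: (@inertia_split R n X X' W D T F P DXT TT Tsym WT XDXT FX FX' _ ciP_sym
  _ _ (F^T *m W^T) ((F^T *m X'^T - 1%:M) *m (D^T *m (W *m T)))
  erefl erefl _ _ _ _ iK).
- by [].
- by rewrite trmx_mul !trmxK.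
- have e : (F^T *m X'^T - 1%:M)^T = X' *m F - 1%:M.
    by rewrite linearB /= trmx_mul !trmxK trmx1.
  rewrite trmx_mul e; congr (_ *m _).
  by rewrite trmx_mul trmxK trmx_mul Tsym.
Qed.

End ComparativeIndex.

(** * Kashiwara index *)

Lemma frame_of_coord (R : realType) (n : nat) (L : {vspace 'cV[R]_(n + n)})
    (Y : 'M[R]_(n + n, n)) :
  frame_of L Y -> exists Yl : 'M[R]_(n, n + n),
    [/\ Yl *m Y = 1%:M, forall c, Y *m c \in L
      & {in L, forall v, Y *m (Yl *m v) = v}].
Proof.
case=> -[_ rY] bY.
have /row_freeP [B YB] : row_free Y^T by rewrite /row_free mxrank_tr rY.
have BY : B^T *m Y = 1%:M by rewrite -[Y]trmxK -trmx_mul YB trmx1.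
have YL c : Y *m c \in L.
  have -> : Y *m c = \sum_j c j 0 *: col j Y.
    apply/colP => i; rewrite !mxE summxE; apply: eq_bigr => j _.
    by rewrite !mxE mulrC.
  apply: memv_suml => j _; apply: memvZ; apply: (basis_mem bY).
  by apply/mapP; exists j; rewrite ?mem_enum.
exists B^T; split => // v vL.
suff [c ->] : exists c, v = Y *m c by rewrite (mulmxA B^T) BY mul1mx.
pose f := linfun (mulmx Y : 'cV[R]_n -> 'cV[R]_(n + n)).
have : (L <= limg f)%VS.
  rewrite -(span_basis bY); apply/span_subvP => u /mapP [j _ ->].
  have -> : col j Y = f (delta_mx j 0) by rewrite lfunE /= colE.
  exact/memv_img/memvf.
move=> /subvP /(_ v vL) /memv_imgP [c _ ->].
by exists c; rewrite lfunE.
Qed.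

Lemma wv_mul (R : realType) (n p q : nat) (Y : 'M[R]_(n + n, p))
    (Z : 'M[R]_(n + n, q)) (c : 'cV[R]_p) (d : 'cV[R]_q) :
  wv (Y *m c) (Z *m d) = bform (w Y Z) c d.
Proof. by rewrite /wv /bform /w trmx_mul !mulmxA. Qed.

(** The frames identify the external direct sum with triples of columns, where the Kashiwara form
    becomes [kform]. *)
Lemma tau3_inertia (R : realType) (n : nat) (L1 L2 L3 : {vspace 'cV[R]_(n + n)})
    (Y1 Y2 Y3 : 'M[R]_(n + n, n)) (p q : nat) :
  frame_of L1 Y1 -> frame_of L2 Y2 -> frame_of L3 Y3 ->
  inertia (kform Y1 Y2 Y3) p q -> tau3 L1 L2 L3 = p%:Z - q%:Z.
Proof.
move=> /frame_of_coord [B1 [BY1 YL1 YB1]] /frame_of_coord [B2 [BY2 YL2 YB2]].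
move=> /frame_of_coord [B3 [BY3 YL3 YB3]] iK.
pose V := (subvs_of L1 * subvs_of L2 * subvs_of L3)%type.
pose phi (v : V) :=
  (B1 *m vsval v.1.1, B2 *m vsval v.1.2, B3 *m vsval v.2).
pose psi (c : 'cV[R]_n * 'cV[R]_n * 'cV[R]_n) : V :=
  (vsproj L1 (Y1 *m c.1.1), vsproj L2 (Y2 *m c.1.2), vsproj L3 (Y3 *m c.2)).
have lphi : linear phi.
  by move=> k u v; rewrite /phi /= !linearP.
have lpsi : linear psi.
  by move=> k u v; rewrite /psi /= !mulmxDr -!scalemxAr !linearP.
have psiK : cancel psi phi.
  case=> [[c1 c2] c3]; rewrite /psi /phi /= !vsprojK //.
  by rewrite !mulmxA BY1 BY2 BY3 !mul1mx.
have phiK : cancel phi psi.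
  case=> [[v1 v2] v3]; rewrite /psi /phi /= YB1 ?YB2 ?YB3 ?subvsP //.
  by rewrite !vsvalK.
have QE v : @kashiwara_form R n L1 L2 L3 v = kform Y1 Y2 Y3 (phi v).
  rewrite -{1}(phiK v); case: (phi v) => [[c1 c2] c3].
  by rewrite /kashiwara_form /= !vsprojK // !wv_mul.
pose x (v : V) := col_mx (col_mx (phi v).1.1 (phi v).1.2) (phi v).2.
pose y (c : 'cV[R]_(n + n + n)) : V :=
  psi (usubmx (usubmx c), dsubmx (usubmx c), dsubmx c).
(* Only the cyclic blocks (1,2), (2,3), (3,1) are filled; symmetry is restored inside
   [signature_exists]. *)
pose M := block_mx (block_mx 0 (w Y1 Y2) 0 0) (col_mx 0 (w Y2 Y3))
  (row_mx (w Y3 Y1) 0) 0.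
apply: (signature_inertia (x := x) (y := y) (M := M)).
- by move=> k u v; rewrite /x lphi /= !scale_col_mx !add_col_mx.
- by move=> k u v; rewrite /y !linearP -lpsi.
- by move=> v; rewrite /x /y !(col_mxKu, col_mxKd) -!surjective_pairing phiK.
- by move=> c; rewrite /x /y psiK /= !vsubmxK.
- move=> v; rewrite QE /kform /cycform /x.
  case: (phi v) => [[c1 c2] c3] /=.
  rewrite /M !tr_col_mx !mul_row_block !mul_row_col !mulmx0 !add0r !addr0.
  rewrite mul_mx_row !mulmx0 ?addr0 ?add0r add_row_mx ?addr0 ?add0r.
  rewrite !mul_row_col.
  by rewrite 2![in RHS]mxE -[RHS]addrA [RHS]addrC.
- exact: (inertia_iso lphi lpsi psiK QE iK).
Qed.

(** * Comparative indices in slope coordinates and the choice of [t] *)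

(** Two inertias of the form of (V, Y, Z) are equated, with rank X = ind A + ind (- A). The formulas
    are kept additive to avoid truncated subtraction. *)
Lemma mu_slope (R : realType) (n : nat) (t : R) (Y Z : 'M[R]_(n + n, n)) :
  is_frame Y -> is_frame Z ->
  slope_den t Y \in unitmx -> slope_den t Z \in unitmx ->
  let A := slope t Y in let B := slope t Z in
  (mu Y Z + ind A = ind (A - B) + ind B)%N /\
  (mu_star Y Z + ind (- A) = ind (B - A) + ind (- B))%N.
Proof.
move=> fY fZ uY uZ A B.
have gY : w Y Y = 0 /\ slope_den t Y \in unitmx by case: fY.
have gZ : w Z Z = 0 /\ slope_den t Z \in unitmx by case: fZ.
have /= := inertia_kform (good_vertical n t) gY gZ.
rewrite slope_vertical sub0r subr0 opprK opprB => /(inertia_kform_vertical fY fZ).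
rewrite -(rank_slope gY) -/A -/B -(ind_rank (slope_sym gY)) -/A => -[E1 E2].
move: E1 E2; move: (mu Y Z) (mu_star Y Z) (ind A) (ind (- A)) (ind B) (ind (- B)).
by move: (ind (A - B)) (ind (B - A)) => i1 i2 i3 i4 i5 i6 i7 i8 E1 E2; split; lia.
Qed.

(** The determinant of U - t X is a polynomial in t, nonzero because at t = i the product (U^T + i
    X^T)(U - i X) is the invertible Gram matrix of the frame. A nonzero product of finitely many
    such polynomials has a non-root. *)
Lemma slope_den_generic (R : realType) (n m : nat)
    (Y : nat -> 'M[R]_(n + n, n)) :
  (forall j, (1 <= j <= m)%N -> is_frame (Y j)) ->
  exists t, forall j, (1 <= j <= m)%N -> slope_den t (Y j) \in unitmx.
Proof.
move=> fY.
pose q j : {poly R} := \det (map_mx polyC (dsubmx (Y j))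
                              - 'X *: map_mx polyC (usubmx (Y j))).
have qE j t : (q j).[t] = \det (slope_den t (Y j)).
  rewrite -[_.[t]]/(horner_eval t _) -det_map_mx; congr (\det _).
  by apply/matrixP => a b; rewrite !mxE /= /horner_eval !hornerE.
have q0 j : (1 <= j <= m)%N -> q j != 0.
  move=> /fY [wY rY]; apply/eqP => qj0.
  pose f := real_complex R; set X := usubmx (Y j); set U := dsubmx (Y j).
  have uS : X^T *m X + U^T *m U \in unitmx by exact: frame_gram_unit.
  have : \det (map_mx f U - 'i *: map_mx f X) = 0.
    have : (map_poly f (q j)).['i] = 0 by rewrite qj0 map_poly0 horner0.
    rewrite -[_.['i]]/(horner_eval 'i _).
    rewrite -!det_map_mx => e; rewrite -[RHS]e; congr (\det _).
    apply/matrixP => a b; rewrite !mxE /= /horner_eval rmorphB rmorphM /=.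
    by rewrite map_polyX !map_polyC /= !hornerE.
  move=> d0; have : \det (map_mx f (X^T *m X + U^T *m U)) = 0.
    have -> : map_mx f (X^T *m X + U^T *m U)
        = (map_mx f U^T + 'i *: map_mx f X^T) *m (map_mx f U - 'i *: map_mx f X).
      rewrite map_mxD !map_mxM mulmxDl !mulmxBr -!scalemxAl -!scalemxAr scalerA.
      rewrite -expr2 sqrCi scaleN1r opprK -!map_mxM (frame_sym wY).
      by rewrite addrA subrK addrC.
    by rewrite det_mulmx d0 mulr0.
  rewrite det_map_mx => /eqP; rewrite fmorph_eq0 => /eqP dS.
  by move: uS; rewrite unitmxE dS unitr0.
pose Q := \prod_(1 <= j < m.+1) q j.
have Q0 : Q != 0.
  rewrite /Q big_seq; apply: (big_ind (fun p => p != 0)) => [|p p'|j].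
  - exact: oner_neq0.
  - exact: mulf_neq0.
  - by rewrite mem_index_iota ltnS; apply: q0.
have [t Qt] : exists t, ~~ root Q t.
  apply: contrapT => h.
  (* Otherwise the numbers 0, ..., [size Q] - 1 would be too many distinct roots. *)
  have : (size Q < size Q)%N; last by rewrite ltnn.
  rewrite -{1}(size_iota 0 (size Q)) -(size_map (fun k => k%:R : R)).
  apply: max_poly_roots => //.
    apply/allP => _ /mapP [k _ ->]; apply: contrapT => /negP rk.
    by apply: h; exists k%:R.
  by rewrite map_inj_uniq ?iota_uniq // => a b /eqP; rewrite eqr_nat => /eqP.
exists t => j jm; rewrite unitmxE unitfE -qE.
apply: contra Qt => /eqP qt; rewrite /root /Q.
rewrite (big_rem j) /=; last by rewrite mem_index_iota ltnS.
by rewrite hornerM qt mul0r.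
Qed.

(** * Cyclic sums *)

Lemma telescope_indices (m : nat) (e : nat -> nat -> int) (a : nat -> int) :
  (1 <= m)%N ->
  \sum_(1 <= k < m) (e k k.+1 + a k.+1 - a k)
    = \sum_(1 <= k < m) e k k.+1 + a m - a 1%N.
Proof.
move=> m1; rewrite (eq_bigr (fun k => e k k.+1 + (a k.+1 - a k))).
  by rewrite big_split /= telescope_sumr // addrA.
by move=> k _; rewrite addrA.
Qed.

Theorem theorem4p1 (R : realType) (n : nat) :
  (forall (L : nat -> {vspace 'cV[R]_(n + n)}) (Y : nat -> 'M[R]_(n + n, n)),
     (forall j, (1 <= j <= 3)%N -> lagrangian (L j)) ->
     (forall j, (1 <= j <= 3)%N -> frame_of (L j) (Y j)) ->
     tau3 (L 1%N) (L 2%N) (L 3%N) = mu_c_plus 3 Y - mu_c_minus 3 Y /\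
     tau3 (L 1%N) (L 2%N) (L 3%N) = nu_c_plus 3 Y - nu_c_minus 3 Y) /\
  (forall (m : nat) (L : nat -> {vspace 'cV[R]_(n + n)})
     (Y : nat -> 'M[R]_(n + n, n)),
     (3 <= m)%N ->
     (forall j, (1 <= j <= m)%N -> lagrangian (L j)) ->
     (forall j, (1 <= j <= m)%N -> frame_of (L j) (Y j)) ->
     (tau m L = mu_c_plus m Y - mu_c_minus m Y /\
      tau m L = nu_c_plus m Y - nu_c_minus m Y) /\
     ((mu_c_plus m Y)%:Q =
        1 / 2 * (rank_sum m Y + (\rank (w (Y m) (Y 1%N)))%:Z + tau m L)%:Q /\
      (mu_c_minus m Y)%:Q =
        1 / 2 * (rank_sum m Y + (\rank (w (Y m) (Y 1%N)))%:Z - tau m L)%:Q) /\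
     ((nu_c_plus m Y)%:Q =
        1 / 2 * (rank_sum m Y - (\rank (w (Y m) (Y 1%N)))%:Z + tau m L)%:Q /\
      (nu_c_minus m Y)%:Q =
        1 / 2 * (rank_sum m Y - (\rank (w (Y m) (Y 1%N)))%:Z - tau m L)%:Q)).
Proof.
(* All the claims are linear identities in four integers: [s1] and [s2] sum ind (A_k - A_(k+1)) and
   ind (A_(k+1) - A_k), while [x] and [y] are ind (A_m - A_1) and ind (A_1 - A_m). *)
suff main (m : nat) (L : nat -> {vspace 'cV[R]_(n + n)})
    (Y : nat -> 'M[R]_(n + n, n)) : (3 <= m)%N ->
    (forall j, (1 <= j <= m)%N -> frame_of (L j) (Y j)) ->
    exists s1 s2 x y : int,
      [/\ mu_c_minus m Y = s1 + x, mu_c_plus m Y = s2 + y,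
          nu_c_minus m Y = s1 - y & nu_c_plus m Y = s2 - x] /\
      [/\ rank_sum m Y = s1 + s2, (\rank (w (Y m) (Y 1%N)))%:Z = x + y
        & tau m L = s2 - s1 + y - x].
  have half (u v : int) : v = 2 * u -> u%:Q = 1 / 2 * v%:Q.
    by move=> ->; rewrite rmorphM /= mulrA mul1r mulVf ?mul1r.
  split=> [L Y _ fL|m L Y m3 _ fL].
    have tau3E : tau3 (L 1%N) (L 2%N) (L 3%N) = tau 3 L by rewrite /tau big_nat1.
    have [s1 [s2 [x [y [[-> -> -> ->] [_ _ tE]]]]]] := main 3 L Y isT fL.
    by rewrite tau3E tE; split; ring.
  have [s1 [s2 [x [y [[-> -> -> ->] [-> -> ->]]]]]] := main m L Y m3 fL.
  split; first by split; ring.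
  by split; split; apply: half; ring.
move=> m3 fL; have fY j : (1 <= j <= m)%N -> is_frame (Y j) by move/fL => -[].
have [t ut] := slope_den_generic fY.
pose A j := slope t (Y j).
pose e j k := (ind (A j - A k))%:Z.
pose a k := (ind (A k))%:Z; pose a' k := (ind (- A k))%:Z.
have good j : (1 <= j <= m)%N -> w (Y j) (Y j) = 0 /\ slope_den t (Y j) \in unitmx.
  by move=> jm; split; [case: (fY j jm) | exact: ut].
have muE j k : (1 <= j <= m)%N -> (1 <= k <= m)%N ->
    (mu (Y j) (Y k))%:Z = e j k + a k - a j.
  move=> jm km; have [E _] := mu_slope (fY j jm) (fY k km) (ut j jm) (ut k km).
  by move: E; rewrite -/(A j) -/(A k) /e /a /a'; lia.
have musE j k : (1 <= j <= m)%N -> (1 <= k <= m)%N ->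
    (mu_star (Y j) (Y k))%:Z = e k j + a' k - a' j.
  move=> jm km; have [_ E] := mu_slope (fY j jm) (fY k km) (ut j jm) (ut k km).
  by move: E; rewrite -/(A j) -/(A k) /e /a /a'; lia.
have rkE j k : (1 <= j <= m)%N -> (1 <= k <= m)%N ->
    (\rank (w (Y j) (Y k)))%:Z = e j k + e k j.
  move=> jm km; rewrite (rank_w_slope (good j jm) (good k km)) -/(A j) -/(A k).
  rewrite -(ind_rank (A := A j - A k)) ?opprB // linearB /=.
  by rewrite (slope_sym (good j jm)) (slope_sym (good k km)).
have t3E i j k : (1 <= i <= m)%N -> (1 <= j <= m)%N -> (1 <= k <= m)%N ->
    tau3 (L i) (L j) (L k) = e j i + e k j + e i k - (e i j + e j k + e k i).
  move=> im jm km.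
  have /= := inertia_kform (good i im) (good j jm) (good k km).
  rewrite -/(A i) -/(A j) -/(A k) !opprB => iK.
  by rewrite (tau3_inertia (fL i im) (fL j jm) (fL k km) iK).
(* From here on only the integer relations just proved matter. *)
clearbody e a a'.
have m1 : (1 <= 1 <= m)%N by lia.
have mm : (1 <= m <= m)%N by lia.
exists (\sum_(1 <= k < m) e k k.+1), (\sum_(1 <= k < m) e k.+1 k), (e m 1%N), (e 1%N m).
have sumE (F G : nat -> int) : (forall k, (1 <= k < m)%N -> F k = G k) ->
    \sum_(1 <= k < m) F k = \sum_(1 <= k < m) G k.
  by move=> FG; apply: eq_big_nat.
have kb k : (1 <= k < m)%N -> (1 <= k <= m)%N /\ (1 <= k.+1 <= m)%N by lia.
(* The boundary terms [a m - a 1%N] left by telescoping cancel against the closing term of each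
   cyclic sum. *)
have muS : \sum_(1 <= k < m) (mu (Y k) (Y k.+1))%:Z
    = \sum_(1 <= k < m) e k k.+1 + a m - a 1%N.
  rewrite -(@telescope_indices m e a); last lia.
  by apply: sumE => k /kb [k1 k2]; rewrite muE.
have musS : \sum_(1 <= k < m) (mu_star (Y k) (Y k.+1))%:Z
    = \sum_(1 <= k < m) e k.+1 k + a' m - a' 1%N.
  rewrite -(@telescope_indices m (fun j k => e k j) a'); last lia.
  by apply: sumE => k /kb [k1 k2]; rewrite musE.
split; split.
- by rewrite /mu_c_minus muS muE //; ring.
- by rewrite /mu_c_plus musS musE //; ring.
- by rewrite /nu_c_minus muS muE //; ring.
- by rewrite /nu_c_plus musS musE //; ring.
- by rewrite /rank_sum -big_split; apply: sumE => k /kb [k1 k2]; rewrite rkE.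
- exact: rkE.
rewrite /tau.
have -> : \sum_(2 <= j < m) tau3 (L 1%N) (L j) (L j.+1) =
    \sum_(2 <= j < m) ((e j.+1 j - e j j.+1)
      + (e 1%N j.+1 - e j.+1 1%N) - (e 1%N j - e j 1%N)).
  apply: eq_big_nat => k kb2; rewrite t3E //; lia.
(* The increments of [g] telescope to [g m - g 2]: the first part is y - x, and the second supplies
   the summand of index 1 absent from the sum defining [tau]. *)
pose g j := e 1%N j - e j 1%N.
rewrite (eq_bigr (fun j => (e j.+1 j - e j j.+1) + (g j.+1 - g j))); last first.
  by move=> j _; rewrite /g; ring.
rewrite big_split /= telescope_sumr; last lia.
rewrite !(big_ltn (_ : 1 < m)%N); try lia.
by rewrite sumrB /g; ring.
Qed.
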